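(* Let $H$ be a complex Hilbert space, $M\subset B(H)$ a von Neumann algebra with commutant $M'$ and centre $Z(M)$, and $T:H\to H$ a bijective antilinear operator such that $$TMT^{-1}=M'\quad\text{and}\quad TzT^{-1}=z^*\ \text{ for all } z\in Z(M).$$ Then $T$ is bounded.
   Context: $B(H)$ is the algebra of all bounded linear operators on $H$. $T$ is everywhere defined and a priori not assumed bounded; $TMT^{-1}=\{TxT^{-1} : x\in M\}$, an equality of sets of maps $H\to H$. *)

(* Defs.v *)
From HB Require Import structures.
From mathcomp Require Import all_boot all_order all_algebra complex.
From mathcomp Require Import boolp classical_sets reals topology normedtype.

Set Implicit Arguments.
Unset Strict Implicit.
Unset Printing Implicit Defensive.

Import Order.TTheory GRing.Theory Num.Theory Num.Def.
Import numFieldNormedType.Exports.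

Local Open Scope classical_set_scope.
Local Open Scope complex_scope.
Local Open Scope ring_scope.

(* A complex Hilbert space is a [completeNormedModType R[i]] together with an
   inner product [dot] (linear in its first argument, conjugate-linear in the
   second) that induces the norm. *)
Definition induces_norm (R : realType) (H : normedModType R[i])
    (dot : {dot H for @conjC R[i]}) : Prop :=
  forall x : H, dot x x = `|x| ^+ 2.

(* [f] is an arbitrary map, so this also applies to antilinear operators; the
   norms take values in [R[i]], whence the embedding [k%:C]. *)
Definition bounded_map (R : realType) (H : normedModType R[i])
    (f : H -> H) : Prop :=
  exists k : R, forall x : H, `|f x| <= k%:C * `|x|.

Definition antilinear (R : realType) (H : lmodType R[i]) (f : H -> H) : Prop :=
  forall (a : R[i]) (x y : H), f (a *: x + y) = conjC a *: f x + f y.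

Definition bounded_operators (R : realType) (H : normedModType R[i]) :
    set (H -> H) :=
  [set a | linear a /\ bounded_map a].

(* [b = a^*], stated by the defining identity of the adjoint. *)
Definition is_adjoint (R : realType) (H : lmodType R[i])
    (dot : {dot H for @conjC R[i]}) (a b : H -> H) : Prop :=
  forall x y : H, dot (a x) y = dot x (b y).

Definition commutant (R : realType) (H : normedModType R[i])
    (A : set (H -> H)) : set (H -> H) :=
  [set y | bounded_operators y /\ forall x, A x -> x \o y = y \o x].

Definition centre (R : realType) (H : normedModType R[i])
    (A : set (H -> H)) : set (H -> H) :=
  A `&` commutant A.

(* Dixmier's definition: a *-subalgebra of B(H) equal to its bicommutant. In
   particular it contains the identity of H. *)
Record von_neumann_algebra (R : realType) (H : normedModType R[i])
    (dot : {dot H for @conjC R[i]}) (M : set (H -> H)) : Prop := {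
  vna_bounded : M `<=` @bounded_operators R H;
  vna_linear : forall (c : R[i]) (a b : H -> H), M a -> M b ->
    M (fun x => c *: a x + b x);
  vna_comp : forall a b : H -> H, M a -> M b -> M (a \o b);
  vna_adjoint : forall a : H -> H, M a -> exists2 b, M b & is_adjoint dot a b;
  vna_bicommutant : commutant (commutant M) = M
}.

(* Main.v *)
Require Import Defs.
From HB Require Import structures.
From mathcomp Require Import all_boot all_order all_algebra complex.
From mathcomp Require Import boolp classical_sets reals topology normedtype.
From mathcomp Require Import ring lra.

Set Implicit Arguments.
Unset Strict Implicit.
Unset Printing Implicit Defensive.

Import Order.TTheory GRing.Theory Num.Theory Num.Def.
Import numFieldNormedType.Exports.

Local Open Scope classical_set_scope.
Local Open Scope complex_scope.
Local Open Scope ring_scope.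

(** Why the theorem holds. Write M' for the commutant of M and th x for
    T x T^-1, so that th is an antilinear algebra isomorphism from M onto M'
    that fixes the central projections, and T x = th x T.

    Discontinuity of T is located by a central projection. Let S be the
    orthogonal complement of the vectors v for which u |-> dot (T u) v is
    bounded. By the uniform boundedness principle S is nonzero when T is
    unbounded ([dense_dom_adj_bounded]). S is invariant under M', so the
    projection z onto the closed span of M S is central and nonzero. If T x is
    bounded then th x kills S, hence th x z = 0, hence x z = 0
    ([discontinuity_projection]). It remains to produce e in M with e z = e,
    e <> 0 and T e bounded.

    A gliding hump ([triangular_bounded]) shows that if a k * b j = 0 for k < j
    then some T (a k) (b k) is bounded. It acts as a chain condition on z M,
    twice.

    First, z M contains a self-adjoint g whose left annihilator does not grow
    under right multiplication ([annihilator_minimal_exists]). If a in g M g is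
    self-adjoint and |a| is its absolute value ([contraction_abs]), then one of
    the factors of (|a| - a) (|a| + a) = 0 vanishes, so a is semidefinite. As
    this applies to all a - t g^2, the corner g M g is one-dimensional, and a
    multiple e of g is a projection with e M e scalar
    ([minimal_projection_exists]).

    Secondly, the left ideal M e carries the scalar product (x, y) |->
    e y^* x e, and Gram-Schmidt in it must stop: there are m_1, ..., m_n in M e
    and r_1, ..., r_n in M such that w = 1 - (m_1 r_1 + ... + m_n r_n) kills
    M e. Then w kills the central cover of e, which th fixes, so th w e = 0
    ([th_kill]) and T e is the sum of the T (th (m_i r_i)) e
    ([finite_orthogonal_system]). Each summand is T (th m_i) f (th r_i) e with
    f = th e, and th r_i commutes with e, so it factors through f e. That
    product has rank one ([fe_rank_one]): M' acts irreducibly on the range of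
    e, and f M' f is scalar. Hence every summand is bounded, and so is T e. *)

(** * Real-valued norms *)

Section RealNorm.
Variables (R : realType) (H : normedModType R[i]).
Implicit Types (x y : H) (a : R[i]) (r : R).

Definition modulus a : R := complex.Re `|a|.
Definition nrm x : R := complex.Re `|x|.

Lemma modulusE a : `|a| = (modulus a)%:C.
Proof. by rewrite RRe_real // normr_real. Qed.

Lemma nrmE x : `|x| = (nrm x)%:C.
Proof. by rewrite RRe_real // normr_real. Qed.

Lemma modulus_ge0 a : 0 <= modulus a.
Proof. by rewrite -ler0c -modulusE. Qed.

Lemma modulus_sqr a : a * conjC a = (modulus a ^+ 2)%:C.
Proof. by rewrite -normCK modulusE rmorphXn. Qed.

Lemma nrm_ge0 x : 0 <= nrm x.
Proof. by rewrite -ler0c -nrmE. Qed.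

Lemma nrm0 : nrm 0 = 0.
Proof. by rewrite /nrm normr0. Qed.

Lemma nrm0_eq0 x : nrm x = 0 -> x = 0.
Proof. by move=> x0; apply/normr0_eq0; rewrite nrmE x0. Qed.

Lemma nrm_gt0 x : x != 0 -> 0 < nrm x.
Proof.
move=> x0; rewrite lt_neqAle nrm_ge0 andbT eq_sym; apply: contraNneq x0.
by move/nrm0_eq0 ->.
Qed.

Lemma nrmD x y : nrm (x + y) <= nrm x + nrm y.
Proof. by rewrite -lecR rmorphD /= -!nrmE ler_normD. Qed.

Lemma nrmN x : nrm (- x) = nrm x.
Proof. by rewrite /nrm normrN. Qed.

Lemma nrmB x y : nrm (x - y) <= nrm x + nrm y.
Proof. by rewrite -(nrmN y) nrmD. Qed.

Lemma nrmC x y : nrm (x - y) = nrm (y - x).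
Proof. by rewrite -nrmN opprB. Qed.

Lemma nrm_split x y z : nrm (x - z) <= nrm (x - y) + nrm (y - z).
Proof. by rewrite -[x in X in X <= _](subrK y) -addrA nrmD. Qed.

Lemma nrmZ a x : nrm (a *: x) = modulus a * nrm x.
Proof. by apply: complexI; rewrite rmorphM /= -nrmE -modulusE -nrmE normrZ. Qed.

Lemma modulusM a b : modulus (a * b) = modulus a * modulus b.
Proof. by apply: complexI; rewrite rmorphM /= -!modulusE normrM. Qed.

Lemma modulus_real r : 0 <= r -> modulus r%:C = r.
Proof. by move=> r0; rewrite /modulus ger0_norm ?ler0c. Qed.

Lemma nrmZr r x : 0 <= r -> nrm (r%:C *: x) = r * nrm x.
Proof. by move=> r0; rewrite nrmZ modulus_real. Qed.

Lemma bounded_mapP (f : H -> H) : bounded_map f <->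
  exists2 k : R, 0 < k & forall x, nrm (f x) <= k * nrm x.
Proof.
split=> [[k fk]|[k _ fk]]; last first.
  by exists k => x; rewrite !nrmE -rmorphM lecR.
exists (`|k| + 1) => [|x]; first by rewrite ltr_pwDr.
have := fk x; rewrite !nrmE -rmorphM lecR => /le_trans; apply.
rewrite ler_wpM2r ?nrm_ge0 //; have := ler_norm k; lra.
Qed.

End RealNorm.

(** * Limits of sequences *)

Lemma small_half_power (R : realType) (e : R) :
  0 < e -> exists n, (2^-1) ^+ n < e.
Proof.
move=> e0; have [n ne] := ltr_add_invr e0.
exists n.+1; rewrite exprVn.
rewrite add0r in ne; apply: le_lt_trans ne.
rewrite lef_pV2 ?posrE ?ltr0n ?exprn_gt0 //.
by rewrite -natrX ler_nat ltnW // ltn_expl.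
Qed.

Lemma le_from_half_powers (R : realType) (x y c : R) :
  (forall n, x <= y + c * (2^-1) ^+ n) -> x <= y.
Proof.
move=> xy; apply/ler_addgt0Pr => e e0.
have c0 : 0 < `|c| + 1 by rewrite ltr_wpDl.
have [n ne] := small_half_power (divr_gt0 e0 c0).
apply: (le_trans (xy n)); rewrite lerD2l.
rewrite ltr_pdivlMr ?ltr_wpDl // in ne.
apply: le_trans (ltW ne); rewrite mulrC ler_wpM2l ?exprn_ge0 ?invr_ge0 //.
by have := ler_norm c; lra.
Qed.

Section Completeness.
Variables (R : realType) (H : completeNormedModType R[i]).

Lemma cauchy_limit (u : nat -> H) (d : nat -> R) :
  (forall n m, (n <= m)%N -> nrm (u m - u n) <= d n) ->
  (forall e, 0 < e -> exists n, d n < e) ->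
  exists l, forall n, nrm (l - u n) <= d n.
Proof.
move=> ud dsmall.
have cu : cvg (u @ \oo).
  apply/cauchy_cvgP/cauchy_exP => -[e e'] /=.
  rewrite ltcE /= => /andP[/eqP e'0 /dsmall[n dn]].
  exists (u n); exists n => // m /= nm.
  rewrite -ball_normE /ball_ /= distrC nrmE e'0 ltcR.
  exact: le_lt_trans (ud n m nm) dn.
exists (lim (u @ \oo)) => n; apply/ler_addgt0Pr => e e0.
have e0' : 0 < (e%:C : R[i]) by rewrite ltcR.
have /cvgrPdist_lt/(_ _ e0')[N _ Nu] := cu.
have /= := Nu (maxn n N) (leq_maxr _ _).
rewrite nrmE ltcR => le.
apply: (le_trans (nrm_split _ (u (maxn n N)) _)).
by rewrite addrC lerD ?ud ?leq_maxl // ltW.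
Qed.

Lemma geometric_limit (u : nat -> H) (r : nat -> R) :
  (forall n, 0 <= r n) -> (forall n, nrm (u n.+1 - u n) <= r n) ->
  (forall n, r n.+1 <= r n / 2) ->
  exists l, forall n, nrm (l - u n) <= 2 * r n.
Proof.
move=> r0 ur rr.
have main n k : nrm (u (n + k)%N - u n) <= 2 * r n - 2 * r (n + k)%N.
  elim: k => [|k IH]; first by rewrite addn0 !subrr nrm0.
  have := nrm_split (u (n + k.+1)%N) (u (n + k)%N) (u n).
  by rewrite addnS; have := ur (n + k)%N; have := rr (n + k)%N; lra.
have rgeo n : r n <= r 0%N * (2^-1) ^+ n.
  elim: n => [|n IH]; first by rewrite mulr1.
  by rewrite exprS; have := rr n; lra.
apply: cauchy_limit => [n m nm|e e0].
  have := main n (m - n)%N; rewrite subnKC // => /le_trans; apply.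
  by have := r0 m; lra.
have p0 : 0 < 2 * r 0%N + 1 by have := r0 0%N; lra.
have [n ne] := small_half_power (divr_gt0 e0 p0).
exists n; rewrite ltr_pdivlMr // in ne; apply: le_lt_trans ne.
have : 0 <= 2^-1 ^+ n :> R by rewrite exprn_ge0 // invr_ge0.
by have := rgeo n; nra.
Qed.

End Completeness.

(** * Geometry of Hilbert space *)

Section InnerProduct.
Variables (R : realType) (H : normedModType R[i]).
Variables (dot : {dot H for @conjC R[i]}) (Hdot : induces_norm dot).
Implicit Types (x y z : H) (a : R[i]).

Lemma dotDl x y z : dot (x + y) z = dot x z + dot y z.
Proof. exact: linearDl. Qed.

Lemma dotDr x y z : dot z (x + y) = dot z x + dot z y.
Proof. exact: linearDr. Qed.

Lemma dotBl x y z : dot (x - y) z = dot x z - dot y z.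
Proof. exact: linearBl. Qed.

Lemma dotBr x y z : dot z (x - y) = dot z x - dot z y.
Proof. exact: linearBr. Qed.

Lemma dotZl a x y : dot (a *: x) y = a * dot x y.
Proof. exact: linearZl_LR. Qed.

Lemma dotZr a x y : dot x (a *: y) = conjC a * dot x y.
Proof. by rewrite linearZr_LR. Qed.

Lemma dot0l x : dot 0 x = 0. Proof. exact: linear0l. Qed.
Lemma dot0r x : dot x 0 = 0. Proof. exact: linear0r. Qed.

Lemma dotC x y : dot x y = conjC (dot y x).
Proof. by rewrite hermC /= mul1r. Qed.

Lemma dot_eq0C x y : dot x y = 0 -> dot y x = 0.
Proof. by rewrite dotC => /eqP; rewrite conjC_eq0 => /eqP. Qed.

Lemma dotxx x : dot x x = (nrm x ^+ 2)%:C.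
Proof. by rewrite Hdot nrmE rmorphXn. Qed.

Lemma dotxx_eq0 x : dot x x = 0 -> x = 0.
Proof.
by rewrite dotxx => -[] /eqP; rewrite sqrf_eq0 => /eqP /nrm0_eq0.
Qed.

Lemma dot_inj x : (forall y, dot x y = 0) -> x = 0.
Proof. by move=> x0; apply: dotxx_eq0. Qed.

Lemma ReD (a b : R[i]) : complex.Re (a + b) = complex.Re a + complex.Re b.
Proof. by case: a; case: b. Qed.

Lemma ReN (a : R[i]) : complex.Re (- a) = - complex.Re a.
Proof. by case: a. Qed.

Lemma ReJ (a : R[i]) : complex.Re (conjC a) = complex.Re a.
Proof. by case: a. Qed.

Lemma ReZ (r : R) (a : R[i]) : complex.Re (r%:C * a) = r * complex.Re a.
Proof. by case: a => b c /=; rewrite mul0r subr0. Qed.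

Lemma conjC_real (r : R) : conjC r%:C = r%:C :> R[i].
Proof. exact: conjc_real. Qed.

Lemma nrm_sqrD x y :
  nrm (x + y) ^+ 2 = nrm x ^+ 2 + nrm y ^+ 2 + 2 * complex.Re (dot x y).
Proof.
have := congr1 (@complex.Re R) (dotxx (x + y)).
rewrite dotDl !dotDr /= !ReD (dotC y x) ReJ !dotxx /=; lra.
Qed.

Lemma nrm_sqrB x y :
  nrm (x - y) ^+ 2 = nrm x ^+ 2 + nrm y ^+ 2 - 2 * complex.Re (dot x y).
Proof.
rewrite nrm_sqrD nrmN -[X in dot x X]scaleN1r dotZr rmorphN rmorph1 mulN1r ReN.
lra.
Qed.

Lemma parallelogram x y :
  nrm (x + y) ^+ 2 + nrm (x - y) ^+ 2 = 2 * nrm x ^+ 2 + 2 * nrm y ^+ 2.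
Proof. by rewrite nrm_sqrD nrm_sqrB; lra. Qed.

(** A vector of minimal length in its coset modulo the line of [y] is
    orthogonal to [y]: moving by a small multiple of [dot x y *: y] would
    otherwise shorten it. *)
Lemma shortest_orthogonal x y :
  (forall a, nrm x <= nrm (x - a *: y)) -> dot x y = 0.
Proof.
move=> xmin; set p := dot x y.
have y0 := nrm_ge0 y; have q0 : 0 < 1 + nrm y ^+ 2 by nra.
pose s := (1 + nrm y ^+ 2)^-1.
have s0 : 0 < s by rewrite invr_gt0.
have sE : s * (1 + nrm y ^+ 2) = 1 by rewrite mulVf ?gt_eqF.
have := xmin (s%:C * p); rewrite -(@ler_pXn2r R 2) ?nnegrE ?nrm_ge0 //.
rewrite nrm_sqrB dotZr -/p rmorphM -mulrA [conjC p * p]mulrC modulus_sqr -scalerA.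
rewrite nrmZr ?(ltW s0) // nrmZ.
have -> : complex.Re (conjC (s%:C) * (modulus p ^+ 2)%:C) = s * modulus p ^+ 2.
  by rewrite /= mulr0 subr0.
rewrite !exprMn => le.
have p2 : modulus p ^+ 2 * s <= 0.
  have -> : modulus p ^+ 2 * s = s * modulus p ^+ 2 * 1 by ring.
  rewrite -[in X in _ * X]sE.
  have := sqr_ge0 (modulus p); nra.
have /eqP : modulus p ^+ 2 = 0.
  apply/eqP; rewrite eq_le sqr_ge0 andbT.
  by rewrite -(pmulr_lle0 _ s0).
rewrite sqrf_eq0 => /eqP p0; apply/normr0_eq0.
by rewrite modulusE p0.
Qed.

Lemma cauchy_schwarz x y : modulus (dot x y) <= nrm x * nrm y.
Proof.
have [->|y0] := eqVneq y 0.
  by rewrite dot0r nrm0 mulr0 /modulus normr0.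
have := nrm_gt0 y0 => ny0.
pose c := dot x y / (nrm y ^+ 2)%:C.
have n20 : (nrm y ^+ 2)%:C != 0 :> R[i].
  by rewrite -[0](rmorph0 (real_complex R)) (inj_eq (@complexI R)) sqrf_eq0 gt_eqF.
have ort : dot (x - c *: y) y = 0 by rewrite dotBl dotZl dotxx divfK ?subrr.
have := nrm_sqrD (x - c *: y) (c *: y).
rewrite subrK dotZr ort mulr0 /= mulr0 addr0 nrmZ => e.
have cE : modulus c * nrm y ^+ 2 = modulus (dot x y).
  rewrite -[in RHS](@divfK _ ((nrm y ^+ 2)%:C) _ (dot x y)) // -/c.
  by rewrite [RHS]modulusM modulus_real ?sqr_ge0.
have le : modulus c * nrm y <= nrm x.
  rewrite -(@ler_pXn2r R 2) ?nnegrE ?mulr_ge0 ?nrm_ge0 ?modulus_ge0 //.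
  by rewrite e lerDr sqr_ge0.
by rewrite -cE expr2 mulrA ler_wpM2r // ltW.
Qed.

Lemma modulusD (a b : R[i]) : modulus (a + b) <= modulus a + modulus b.
Proof. by rewrite -lecR rmorphD /= -!modulusE ler_normD. Qed.

Lemma modulusJ (a : R[i]) : modulus (conjC a) = modulus a.
Proof. by rewrite /modulus norm_conjC. Qed.

Lemma modulus0 : modulus (0 : R[i]) = 0.
Proof. by rewrite /modulus normr0. Qed.

Lemma Re_le_modulus (a : R[i]) : complex.Re a <= modulus a.
Proof.
have := normc_ge_Re a; rewrite modulusE lecR; apply: le_trans; exact: ler_norm.
Qed.

End InnerProduct.

Section Projection.
Variables (R : realType) (H : completeNormedModType R[i]).
Variables (dot : {dot H for @conjC R[i]}) (Hdot : induces_norm dot).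

Definition closed_subspace (V : set H) : Prop :=
  [/\ V 0, forall (a : R[i]) x y, V x -> V y -> V (a *: x + y) &
      forall x, (forall e : R, 0 < e -> exists2 y, V y & nrm (x - y) < e) ->
        V x].

(** By the parallelogram law, applied at the midpoint, almost nearest points of
    [V] to [x] are close to each other; their limit is the foot of the
    perpendicular. *)
Lemma orthogonal_decomposition (V : set H) (x : H) : closed_subspace V ->
  exists2 y, V y & forall w, V w -> dot (x - y) w = 0.
Proof.
move=> [V0 Vlin Vcl].
pose D := [set nrm (x - y) ^+ 2 | y in V].
have hD : has_inf D.
  split; first by exists (nrm (x - 0) ^+ 2), 0.
  by exists 0 => _ [y _ <-]; exact: sqr_ge0.
have h0 n : 0 < (2^-1) ^+ n :> R by rewrite exprn_gt0 // invr_gt0.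
have near n : exists y, V y /\ nrm (x - y) ^+ 2 < inf D + ((2^-1) ^+ n) ^+ 2.
  have [_ [y Vy <-] lt] := inf_adherent (exprn_gt0 2 (h0 n)) hD.
  by exists y.
have [u uP] := choice near.
have minD y : V y -> inf D <= nrm (x - y) ^+ 2.
  by move=> Vy; apply: ge_inf; [case: hD | exists y].
have [l lP] : exists l, forall n, nrm (l - u n) <= 2 * (2^-1) ^+ n.
  apply: cauchy_limit => [n m nm|e e0]; last first.
    have [n ne] := small_half_power (divr_gt0 e0 (ltr0Sn R 1)).
    by exists n; lra.
  rewrite -(@ler_pXn2r R 2) ?nnegrE ?nrm_ge0 ?mulr_ge0 ?(ltW (h0 _)) //.
  have [[Vn nn] [Vm mm]] := (uP n, uP m).
  have le : (2^-1) ^+ m <= (2^-1) ^+ n :> R.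
    by rewrite ler_wiXn2l ?invr_ge0 // invf_le1 // ler1n.
  have := parallelogram Hdot (x - u n) (x - u m).
  have -> : x - u n - (x - u m) = u m - u n by rewrite opprB addrC addrA subrK.
  (* the sum is twice the distance vector to the midpoint *)
  pose w := (2^-1 : R)%:C *: (u n + u m).
  have Vw : V w.
    rewrite -[w]addr0; apply: (Vlin) => //; rewrite -[u n]scale1r; exact: Vlin.
  have -> : x - u n + (x - u m) = (2 : R)%:C *: (x - w).
    rewrite scalerBr scalerA -rmorphM divff ?pnatr_eq0 // rmorph1 scale1r.
    by rewrite rmorphD !rmorph1 scalerDl scale1r opprD addrACA.
  rewrite nrmZr // exprMn; have := minD _ Vw; have := h0 m; nra.
have Vl : V l.
  apply: Vcl => e e0; have [n ne] := small_half_power (divr_gt0 e0 (ltr0Sn R 1)).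
  by exists (u n); [case: (uP n) | have := lP n; lra].
exists l => //.
have lmin v : V v -> nrm (x - l) <= nrm (x - v).
  move=> Vv; apply: (@le_from_half_powers _ _ _ 3) => n.
  have [_ un] := uP n; have := minD _ Vv => mv.
  have : nrm (x - u n) <= nrm (x - v) + (2^-1) ^+ n.
    rewrite -(@ler_pXn2r R 2) ?nnegrE ?addr_ge0 ?nrm_ge0 ?(ltW (h0 _)) //.
    rewrite sqrrD mulr2n; have := mulr_ge0 (nrm_ge0 (x - v)) (ltW (h0 n)); lra.
  have := nrm_split x (u n) l; rewrite (nrmC (u n)).
  have := lP n; lra.
move=> w Vw; apply: (shortest_orthogonal Hdot) => a.
rewrite -addrA -opprD; apply: lmin; rewrite addrC; exact: Vlin.
Qed.

(** Riesz representation: a vector orthogonal to the kernel of [f] represents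
    [f] up to a scalar. *)
Lemma riesz (f : H -> R[i]) (k : R) :
  (forall a x y, f (a *: x + y) = a * f x + f y) ->
  (forall x, modulus (f x) <= k * nrm x) ->
  exists z, forall x, f x = dot x z.
Proof.
move=> flin fk.
have f0 : f 0 = 0.
  have := flin 1 0 0; rewrite scaler0 addr0 mul1r => /eqP.
  by rewrite -subr_eq0 opprD addrA subrr sub0r oppr_eq0 => /eqP.
have fZ a x : f (a *: x) = a * f x by rewrite -[a *: x]addr0 flin f0 addr0.
pose V := [set x | f x = 0].
have Vcl : closed_subspace V.
  split=> // [a x y|x near].
    by rewrite /V /= flin => -> ->; rewrite mulr0 addr0.
  apply/normr0_eq0; rewrite modulusE; congr (_%:C).
  apply/eqP; rewrite eq_le modulus_ge0 andbT; apply/ler_addgt0Pr => e e0.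
  rewrite add0r.
  have k0 : 0 < `|k| + 1 by rewrite ltr_wpDl.
  have [y fy] := near _ (divr_gt0 e0 k0).
  rewrite ltr_pdivlMr // => lt.
  have -> : f x = f (x - y).
    by rewrite addrC -scaleN1r flin fy mulr0 add0r.
  apply: le_trans (fk _) (le_trans _ (ltW lt)).
  rewrite mulrC ler_wpM2l ?nrm_ge0 //; have := ler_norm k; lra.
have [all0|/existsNP[x0 fx0]] := pselect (forall x, f x = 0).
  by exists 0 => x; rewrite dot0r.
have [y fy ort] := orthogonal_decomposition x0 Vcl.
set u := x0 - y in ort.
have fu : f u = f x0 by rewrite /u addrC -scaleN1r flin fy mulr0 add0r.
have uu : dot u u != 0.
  apply/eqP => /(dotxx_eq0 Hdot) u0; apply: fx0; rewrite -fu u0.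
  exact: f0.
exists (conjC (f u / dot u u) *: u) => x.
rewrite dotZr conjCK.
have : dot u (- f x *: u + f u *: x) = 0.
  by apply: ort; rewrite /V /= flin fZ; ring.
move/dot_eq0C; rewrite dotDl !dotZl => /eqP; rewrite mulNr addrC subr_eq0.
by move=> /eqP e; apply: (mulIf uu); rewrite -e mulrAC divfK.
Qed.

End Projection.

(** * The algebra of bounded operators *)

(** Bounded operators are bundled so that they carry the structure of an
    algebra over the complex numbers, which makes the ring lemmas available. *)
Record bop (R : realType) (H : normedModType R[i]) := Bop {
  bop_fun :> H -> H;
  bop_linear : linear bop_fun;
  bop_bounded : bounded_map bop_fun
}.

HB.instance Definition _ (R : realType) (H : normedModType R[i]) (a : bop H) :=
  GRing.isLinear.Build R[i] H H *:%R (bop_fun a) (bop_linear a).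

Section OperatorAlgebra.
Variables (R : realType) (H : normedModType R[i]).
Implicit Types (a b : bop H) (x y : H).

Lemma bopP a b : (forall x, a x = b x) -> a = b.
Proof.
case: a b => [f lf bf] [g lg bg] /= /funext fg.
by case: _ / fg in lg bg *; congr Bop; exact: Prop_irrelevance.
Qed.

HB.instance Definition _ := gen_eqMixin (bop H).
HB.instance Definition _ := gen_choiceMixin (bop H).

Lemma bop_bound a : exists2 k : R, 0 < k & forall x, nrm (a x) <= k * nrm x.
Proof. exact/bounded_mapP/bop_bounded. Qed.

Program Definition bop0 : bop H := @Bop _ _ (fun=> 0) _ _.
Next Obligation. by move=> c x y; rewrite scaler0 addr0. Qed.
Next Obligation. by exists 0 => x; rewrite normr0 mul0r. Qed.

Program Definition bop1 : bop H := @Bop _ _ id _ _.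
Next Obligation. by []. Qed.
Next Obligation. by exists 1 => x; rewrite mul1r. Qed.

Program Definition bop_opp a : bop H := @Bop _ _ (fun x => - a x) _ _.
Next Obligation. by move=> a c x y /=; rewrite linearP opprD scalerN. Qed.
Next Obligation.
by move=> a; have [k ak] := bop_bounded a; exists k => x; rewrite normrN.
Qed.

Program Definition bop_add a b : bop H := @Bop _ _ (fun x => a x + b x) _ _.
Next Obligation. by move=> a b c x y /=; rewrite !linearP scalerDr addrACA. Qed.
Next Obligation.
move=> a b; have [k k0 ak] := bop_bound a; have [l l0 bl] := bop_bound b.
apply/bounded_mapP; exists (k + l) => [|x]; first by lra.
by rewrite mulrDl; apply: le_trans (nrmD _ _) (lerD (ak x) (bl x)).
Qed.

Program Definition bop_mul a b : bop H := @Bop _ _ (a \o b) _ _.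
Next Obligation. by move=> a b c x y /=; rewrite !linearP. Qed.
Next Obligation.
move=> a b; have [k k0 ak] := bop_bound a; have [l l0 bl] := bop_bound b.
apply/bounded_mapP; exists (k * l) => [|x /=]; first by rewrite mulr_gt0.
by apply: le_trans (ak _) _; rewrite -mulrA ler_wpM2l // ltW.
Qed.

Program Definition bop_scale (c : R[i]) a : bop H :=
  @Bop _ _ (fun x => c *: a x) _ _.
Next Obligation.
by move=> c a d x y /=; rewrite linearP scalerDr !scalerA mulrC.
Qed.
Next Obligation.
move=> c a; have [k k0 ak] := bop_bound a; apply/bounded_mapP.
exists ((modulus c + 1) * k) => [|x].
  by rewrite mulr_gt0 // ltr_wpDl // modulus_ge0.
rewrite nrmZ -mulrA ler_pM ?modulus_ge0 ?nrm_ge0 //; lra.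
Qed.

Fact bop_addA : associative bop_add.
Proof. by move=> a b c; apply: bopP => x; rewrite /= addrA. Qed.
Fact bop_addC : commutative bop_add.
Proof. by move=> a b; apply: bopP => x; rewrite /= addrC. Qed.
Fact bop_add0 : left_id bop0 bop_add.
Proof. by move=> a; apply: bopP => x; rewrite /= add0r. Qed.
Fact bop_addN : left_inverse bop0 bop_opp bop_add.
Proof. by move=> a; apply: bopP => x; rewrite /= addNr. Qed.

HB.instance Definition _ :=
  GRing.isZmodule.Build (bop H) bop_addA bop_addC bop_add0 bop_addN.

Fact bop_mulA : associative bop_mul.
Proof. by move=> a b c; apply: bopP. Qed.
Fact bop_mul1l : left_id bop1 bop_mul.
Proof. by move=> a; apply: bopP. Qed.
Fact bop_mul1r : right_id bop1 bop_mul.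
Proof. by move=> a; apply: bopP. Qed.
Fact bop_mulDl : left_distributive bop_mul bop_add.
Proof. by move=> a b c; apply: bopP. Qed.
Fact bop_mulDr : right_distributive bop_mul bop_add.
Proof. by move=> a b c; apply: bopP => x /=; rewrite linearD. Qed.

HB.instance Definition _ := GRing.Zmodule_isPzRing.Build (bop H)
  bop_mulA bop_mul1l bop_mul1r bop_mulDl bop_mulDr.

Fact bop_scaleA c d a : bop_scale c (bop_scale d a) = bop_scale (c * d) a.
Proof. by apply: bopP => x; rewrite /= scalerA. Qed.
Fact bop_scale1 : left_id 1 bop_scale.
Proof. by move=> a; apply: bopP => x; rewrite /= scale1r. Qed.
Fact bop_scaleDr : right_distributive bop_scale +%R.
Proof. by move=> c a b; apply: bopP => x; rewrite /= scalerDr. Qed.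
Fact bop_scaleDl a : {morph bop_scale^~ a : c d / c + d}.
Proof. by move=> c d; apply: bopP => x; rewrite /= scalerDl. Qed.

HB.instance Definition _ := GRing.Zmodule_isLmodule.Build R[i] (bop H)
  bop_scaleA bop_scale1 bop_scaleDr bop_scaleDl.

Lemma bop_scaleAl (c : R[i]) (a b : bop H) : c *: (a * b) = (c *: a) * b.
Proof. exact: bopP. Qed.

Lemma bop_scaleAr (c : R[i]) (a b : bop H) : c *: (a * b) = a * (c *: b).
Proof. by apply: bopP => x /=; rewrite linearZ. Qed.

Lemma bopDE a b x : (a + b) x = a x + b x. Proof. by []. Qed.
Lemma bopNE a x : (- a) x = - a x. Proof. by []. Qed.
Lemma bopBE a b x : (a - b) x = a x - b x. Proof. by []. Qed.
Lemma bopME a b x : (a * b) x = a (b x). Proof. by []. Qed.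
Lemma bopZE c a x : (c *: a) x = c *: a x. Proof. by []. Qed.
Lemma bop0E x : (0 : bop H) x = 0. Proof. by []. Qed.
Lemma bop1E x : (1 : bop H) x = x. Proof. by []. Qed.

End OperatorAlgebra.

Section Adjoint.
Variables (R : realType) (H : completeNormedModType R[i]).
Variables (dot : {dot H for @conjC R[i]}) (Hdot : induces_norm dot).
Implicit Types (a b : bop H) (x y : H).

Lemma adjoint_exists a :
  exists b : bop H, forall x y, dot (a x) y = dot x (b y).
Proof.
have [k k0 ak] := bop_bound a.
have rep y : exists z, forall x, dot (a x) y = dot x z.
  apply: (@riesz _ _ _ Hdot (fun x => dot (a x) y) (k * nrm y)) => [c x z|x].
    by rewrite /= linearP dotDl dotZl.
  apply: le_trans (cauchy_schwarz Hdot _ _) _.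
  by rewrite mulrAC ler_wpM2r ?nrm_ge0.
have [g gP] := choice rep.
have glin : linear g.
  move=> c x y; apply/eqP; rewrite -subr_eq0; apply/eqP/(dotxx_eq0 Hdot).
  by rewrite dotBr dotDr dotZr -!gP dotDr dotZr subrr.
have gbd : bounded_map g.
  apply/bounded_mapP; exists k => // y.
  have [->|gy0] := eqVneq (g y) 0.
    by rewrite nrm0 mulr_ge0 ?nrm_ge0 // ltW.
  have gy := nrm_gt0 gy0; rewrite -(ler_pM2r gy).
  have := congr1 (@complex.Re R) (dotxx Hdot (g y)).
  rewrite -gP /= -expr2 => <-.
  apply: le_trans (Re_le_modulus _) (le_trans (cauchy_schwarz Hdot _ _) _).
  by rewrite mulrAC ler_wpM2r ?nrm_ge0.
by exists (Bop glin gbd) => x y; rewrite gP.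
Qed.

Definition adj a : bop H := sval (cid (adjoint_exists a)).

Lemma adjP a x y : dot (a x) y = dot x (adj a y).
Proof. by rewrite /adj; case: cid. Qed.

Lemma adj_dotr a x y : dot x (a y) = dot (adj a x) y.
Proof. by rewrite dotC (adjP a) -dotC. Qed.

Lemma adj_uniq a b : (forall x y, dot (a x) y = dot x (b y)) -> adj a = b.
Proof.
move=> ab; apply: bopP => y; apply/eqP; rewrite -subr_eq0; apply/eqP.
by apply: (dotxx_eq0 Hdot); rewrite dotBr -ab adjP subrr.
Qed.

Lemma adjK a : adj (adj a) = a.
Proof. by apply: adj_uniq => x y; rewrite -adj_dotr. Qed.

Lemma adjM a b : adj (a * b) = adj b * adj a.
Proof. by apply: adj_uniq => x y; rewrite !bopME !adjP. Qed.

Lemma adjD a b : adj (a + b) = adj a + adj b.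
Proof. by apply: adj_uniq => x y; rewrite !bopDE dotDl dotDr !adjP. Qed.

Lemma adjZ c a : adj (c *: a) = conjC c *: adj a.
Proof. by apply: adj_uniq => x y; rewrite !bopZE dotZl dotZr conjCK adjP. Qed.

Lemma adjN a : adj (- a) = - adj a.
Proof. by rewrite -scaleN1r adjZ rmorphN rmorph1 scaleN1r. Qed.

Lemma adjB a b : adj (a - b) = adj a - adj b.
Proof. by rewrite adjD adjN. Qed.

Lemma adj1 : adj 1 = 1.
Proof. exact: adj_uniq. Qed.

Lemma adj_mul_eq0 a : adj a * a = 0 -> a = 0.
Proof.
move=> aa; apply: bopP => x; apply: (dotxx_eq0 Hdot).
by rewrite adjP -bopME aa dot0r.
Qed.

Lemma selfadjoint_sqr_eq0 a : adj a = a -> a * a = 0 -> a = 0.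
Proof. by move=> sa aa; apply: adj_mul_eq0; rewrite sa. Qed.

End Adjoint.

(** * Absolute values of self-adjoint operators *)

Section OperatorBounds.
Variables (R : realType) (H : completeNormedModType R[i]).
Implicit Types (a b : bop H) (x y : H) (k : R).

Definition opnorm_le a k := forall x, nrm (a x) <= k * nrm x.

Lemma opnorm_leW a k (l : R) : k <= l -> opnorm_le a k -> opnorm_le a l.
Proof.
by move=> kl ak x; apply: le_trans (ak x) _; rewrite ler_wpM2r ?nrm_ge0.
Qed.

Lemma opnorm_leD a b k (l : R) :
  opnorm_le a k -> opnorm_le b l -> opnorm_le (a + b) (k + l).
Proof.
by move=> ak bl x; rewrite mulrDl; apply: le_trans (nrmD _ _) (lerD (ak x) (bl x)).
Qed.

Lemma opnorm_leN a k : opnorm_le a k -> opnorm_le (- a) k.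
Proof. by move=> ak x; rewrite bopNE nrmN. Qed.

Lemma opnorm_leM a b k (l : R) : 0 <= k ->
  opnorm_le a k -> opnorm_le b l -> opnorm_le (a * b) (k * l).
Proof.
by move=> k0 ak bl x; apply: le_trans (ak _) _; rewrite -mulrA ler_wpM2l.
Qed.

Lemma opnorm_leZ (r : R) a k : 0 <= r ->
  opnorm_le a k -> opnorm_le (r%:C *: a) (r * k).
Proof. by move=> r0 ak x; rewrite bopZE nrmZr // -mulrA ler_wpM2l. Qed.

Lemma opnorm_le_eq0 a : (forall e, 0 < e -> opnorm_le a e) -> a = 0.
Proof.
move=> small; apply: bopP => x; apply: nrm0_eq0.
have [->|x0] := eqVneq x 0; first by rewrite linear0 nrm0.
apply/eqP; rewrite eq_le nrm_ge0 andbT; apply/ler_addgt0Pr => e e0; rewrite add0r.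
have := small _ (divr_gt0 e0 (nrm_gt0 x0)) x.
by rewrite divfK // gt_eqF // nrm_gt0.
Qed.

Lemma operator_limit (u : nat -> bop H) (d : nat -> R) :
  (forall n, 0 <= d n) ->
  (forall n m, (n <= m)%N -> opnorm_le (u m - u n) (d n)) ->
  (forall e, 0 < e -> exists n, d n < e) ->
  exists l : bop H, forall n, opnorm_le (l - u n) (d n).
Proof.
move=> d0 ud dsmall.
have lim_at x : exists l, forall n, nrm (l - u n x) <= d n * nrm x.
  apply: cauchy_limit => [n m nm|e e0]; first exact: ud.
  have x0 : 0 < nrm x + 1 by rewrite ltr_wpDl ?nrm_ge0.
  have [n ne] := dsmall _ (divr_gt0 e0 x0).
  exists n; rewrite ltr_pdivlMr // in ne; apply: le_lt_trans ne.
  by rewrite ler_wpM2l // lerDl.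
have [f fu] := choice lim_at.
have flin : linear f.
  move=> c x y; apply/eqP; rewrite -subr_eq0; apply/eqP/nrm0_eq0/eqP.
  rewrite eq_le nrm_ge0 andbT; apply/ler_addgt0Pr => e e0; rewrite add0r.
  pose K := nrm (c *: x + y) + modulus c * nrm x + nrm y.
  have K0 : 0 < K + 1.
    by rewrite ltr_wpDl ?addr_ge0 ?mulr_ge0 ?nrm_ge0 ?modulus_ge0.
  have [n ne] := dsmall _ (divr_gt0 e0 K0).
  rewrite ltr_pdivlMr // in ne.
  have -> : f (c *: x + y) - (c *: f x + f y) =
      (f (c *: x + y) - u n (c *: x + y)) - (c *: (f x - u n x) + (f y - u n y)).
    have -> : c *: (f x - u n x) + (f y - u n y) =
        (c *: f x + f y) - (c *: u n x + u n y).
      by rewrite scalerBr addrACA -opprD.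
    by rewrite (linearP (u n)) opprB addrA subrK.
  apply: le_trans (nrmB _ _) _; apply: le_trans (lerD (lexx _) (nrmD _ _)) _.
  rewrite nrmZ; have := fu (c *: x + y) n.
  have := ler_wpM2l (modulus_ge0 c) (fu x n); have := fu y n; have := d0 n.
  rewrite /K in ne; lra.
have fbd : bounded_map f.
  have [k k0 uk] := bop_bound (u 0%N).
  apply/bounded_mapP; exists (d 0%N + k) => [|x]; first by rewrite ltr_wpDl.
  rewrite -[f x](subrK (u 0%N x)) mulrDl.
  exact: le_trans (nrmD _ _) (lerD (fu x _) (uk x)).
by exists (Bop flin fbd) => n x; exact: fu.
Qed.

End OperatorBounds.

Section SquareRoot.
Variables (R : realType) (H : completeNormedModType R[i]).
Variables (dot : {dot H for @conjC R[i]}) (Hdot : induces_norm dot).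
Implicit Types (a b c : bop H).
Local Notation adj := (adj Hdot).

Lemma adj_opnorm_le a k : 0 <= k -> opnorm_le a k -> opnorm_le (adj a) k.
Proof.
move=> k0 ak y.
have [->|gy0] := eqVneq (adj a y) 0; first by rewrite nrm0 mulr_ge0 ?nrm_ge0.
have gy := nrm_gt0 gy0; rewrite -(ler_pM2r gy).
have := congr1 (@complex.Re R) (dotxx Hdot (adj a y)).
rewrite -adjP /= -expr2 => <-.
apply: le_trans (Re_le_modulus _) (le_trans (cauchy_schwarz Hdot _ _) _).
by rewrite mulrAC ler_wpM2r ?nrm_ge0.
Qed.

(** The scalar companion of the iteration below; it bounds the iterates and
    their increments. *)
Fixpoint sqrt_scalar n : R :=
  if n is m.+1 then (1 + sqrt_scalar m ^+ 2) / 2 else 0.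

Fixpoint sqrt_iter (b : bop H) n : bop H :=
  if n is m.+1 then (2^-1 : R)%:C *: (b + sqrt_iter b m * sqrt_iter b m) else 0.

Lemma sqrt_scalar_itv n : 0 <= sqrt_scalar n <= 1.
Proof. by elim: n => [|n] /=; rewrite ?lexx ?ler01 // => /andP[? ?]; nra. Qed.

Lemma sqrt_scalar_inc n m : (n <= m)%N -> sqrt_scalar n <= sqrt_scalar m.
Proof.
move=> /subnKC <-; elim: (m - n)%N => [|k IH]; first by rewrite addn0.
rewrite addnS; apply: le_trans IH _ => /=.
have := sqr_ge0 (sqrt_scalar (n + k)%N - 1); lra.
Qed.

Lemma sqrt_iter_comm b c n : c * b = b * c ->
  c * sqrt_iter b n = sqrt_iter b n * c.
Proof.
move=> cb; elim: n => [|n IH] /=; first by rewrite mulr0 mul0r.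
rewrite -bop_scaleAr -bop_scaleAl mulrDr mulrDl cb; congr (_ *: (_ + _)).
by rewrite mulrA IH -mulrA IH mulrA.
Qed.

Lemma sqrt_iter_le b n : opnorm_le b 1 -> opnorm_le (sqrt_iter b n) (sqrt_scalar n).
Proof.
move=> b1; elim: n => [|n IH] /=; first by move=> x; rewrite nrm0 mul0r.
have [t0 _] := andP (sqrt_scalar_itv n).
rewrite mulrC; apply: opnorm_leZ; first by rewrite invr_ge0.
by apply: opnorm_leD => //; apply: opnorm_leM.
Qed.

Lemma sqrt_iter_step b n : opnorm_le b 1 ->
  opnorm_le (sqrt_iter b n.+1 - sqrt_iter b n) (sqrt_scalar n.+1 - sqrt_scalar n).
Proof.
move=> b1; elim: n => [|n IH].
  rewrite /= !subr0 mul0r expr0n /= !addr0 mulrC.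
  by apply: opnorm_leZ => //; rewrite invr_ge0.
set u := sqrt_iter b n.+1 in IH *; set v := sqrt_iter b n in IH *.
have uv : u * v = v * u.
  apply: sqrt_iter_comm; apply/esym; exact: sqrt_iter_comm.
have -> : sqrt_iter b n.+2 - u = (2^-1 : R)%:C *: ((u + v) * (u - v)).
  have -> : sqrt_iter b n.+2 - u =
      (2^-1 : R)%:C *: (b + u * u) - (2^-1 : R)%:C *: (b + v * v) by [].
  rewrite -scalerBr; congr (_ *: _).
  have -> : (u + v) * (u - v) = u * u - v * v.
    by rewrite mulrBr !mulrDl uv opprD addrA addrK.
  by rewrite opprD addrACA subrr add0r.
have -> : sqrt_scalar n.+2 - sqrt_scalar n.+1 =
    2^-1 * ((sqrt_scalar n.+1 + sqrt_scalar n) * (sqrt_scalar n.+1 - sqrt_scalar n)).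
  rewrite [sqrt_scalar n.+2]/= [X in _ - X = _]/=.
  have -> : sqrt_scalar n.+1 = (1 + sqrt_scalar n ^+ 2) / 2 by [].
  by field.
apply: opnorm_leZ; first by rewrite invr_ge0.
apply: opnorm_leM => //.
  have /andP[? _] := sqrt_scalar_itv n.+1; have /andP[? _] := sqrt_scalar_itv n.
  exact: addr_ge0.
by apply: opnorm_leD; exact: sqrt_iter_le.
Qed.

Lemma sqrt_iter_adj b n : adj b = b -> adj (sqrt_iter b n) = sqrt_iter b n.
Proof.
move=> sb; elim: n => [|n IH] /=.
  by apply: adj_uniq => x y; rewrite dot0l dot0r.
by rewrite adjZ adjD adjM IH sb conjC_real.
Qed.

(** The absolute value of a self-adjoint contraction [a], obtained as [1 - y]
    where [y] solves [y = (b + y ^ 2) / 2] with [b = 1 - a ^ 2]: the iterates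
    from [0] converge in norm because the iterates of the scalar equation with
    [b = 1] increase to a finite limit and dominate all increments. *)
Lemma contraction_abs a : adj a = a -> opnorm_le a 1 ->
  exists s : bop H, [/\ adj s = s, s * s = a * a,
    forall c, c * a = a * c -> c * s = s * c &
    forall x, 0 <= complex.Re (dot (s x) x)].
Proof.
move=> sa a1; pose b := 1 - a * a.
have sb : adj b = b by rewrite adjB adj1 adjM sa.
have b1 : opnorm_le b 1.
  move=> x; rewrite mul1r -(@ler_pXn2r R 2) ?nnegrE ?nrm_ge0 //.
  rewrite bopBE bop1E (nrm_sqrB Hdot) bopME (adj_dotr Hdot) sa dotxx //=.
  have : nrm (a (a x)) ^+ 2 <= nrm (a x) ^+ 2.
    by rewrite ler_pXn2r ?nnegrE ?nrm_ge0 // -[nrm (a x)]mul1r; exact: a1.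
  have := sqr_ge0 (nrm (a x)); lra.
pose u := sqrt_iter b; pose t := sqrt_scalar.
have ht : has_sup (range t).
  split; first by exists (t 0%N), 0%N.
  by exists 1 => _ [n _ <-]; have /andP[] := sqrt_scalar_itv n.
pose d n := sup (range t) - t n.
have d0 n : 0 <= d n by rewrite subr_ge0; apply: sup_upper_bound => //; exists n.
have ud n m : (n <= m)%N -> opnorm_le (u m - u n) (d n).
  move=> /subnKC <-; apply: (@opnorm_leW _ _ _ (t (n + (m - n))%N - t n)).
    by rewrite lerD2r; apply: sup_upper_bound => //; eexists.
  elim: (m - n)%N => [|k IH].
    by rewrite addn0 !subrr => x; rewrite nrm0 mul0r.
  rewrite addnS.
  have -> : u (n + k).+1 - u n = (u (n + k).+1 - u (n + k)%N) + (u (n + k)%N - u n).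
    by rewrite addrA subrK.
  have -> : t (n + k).+1 - t n = (t (n + k).+1 - t (n + k)%N) + (t (n + k)%N - t n).
    by rewrite addrA subrK.
  by apply: opnorm_leD => //; exact: sqrt_iter_step.
have dsmall e : 0 < e -> exists n, d n < e.
  by move=> e0; have [_ [n _ <-] lt] := sup_adherent e0 ht; exists n; rewrite /d; lra.
have [y yu] := operator_limit d0 ud dsmall.
have t_le n : t n <= 1 by have /andP[] := sqrt_scalar_itv n.
have u1 n : opnorm_le (u n) 1 := opnorm_leW (t_le n) (sqrt_iter_le n b1).
have y1 : opnorm_le y 1.
  move=> x; rewrite mul1r.
  have s1 : sup (range t) <= 1 by apply: ge_sup; [case: ht | move=> _ [n _ <-]].
  have := yu 0%N x; rewrite /u /= subr0 /d /t /= subr0 => /le_trans; apply.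
  by rewrite ler_piMl ?nrm_ge0.
have vanish (c : bop H) K : 0 < K -> (forall n, opnorm_le c (K * d n)) -> c = 0.
  move=> K0 cK; apply: opnorm_le_eq0 => e e0.
  have [n ne] := dsmall _ (divr_gt0 e0 K0).
  by apply: opnorm_leW (cK n); rewrite ltr_pdivlMr // in ne; rewrite mulrC ltW.
have sy : adj y = y.
  apply/eqP; rewrite -subr_eq0; apply/eqP; apply: (vanish _ 2) => // n.
  have -> : adj y - y = adj (y - u n) - (y - u n).
    by rewrite adjB /u sqrt_iter_adj // opprB addrA subrK.
  rewrite mulr_natl mulr2n; apply: opnorm_leD; first exact: adj_opnorm_le.
  exact: opnorm_leN.
have fixy : y = (2^-1 : R)%:C *: (b + y * y).
  apply/eqP; rewrite -subr_eq0; apply/eqP; apply: (vanish _ 2) => // n.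
  have e1 : y * y - u n * u n = y * (y - u n) + (y - u n) * u n.
    by rewrite mulrBr mulrBl addrA subrK.
  have -> : y - (2^-1 : R)%:C *: (b + y * y) =
      (y - u n.+1) - (2^-1 : R)%:C *: (y * y - u n * u n).
    have shift (v w z : bop H) (r : R[i]) :
        y - r *: (v + w) = (y - r *: (v + z)) - r *: (w - z).
      rewrite -addrA -opprD -scalerDr; congr (_ - _ *: _).
      by rewrite -addrA [z + _]addrC subrK.
    exact: shift.
  have le : d n.+1 <= d n by rewrite lerD2l lerN2; exact: sqrt_scalar_inc.
  have -> : 2 * d n = d n + 2^-1 * (1 * d n + d n * 1) by field.
  apply: opnorm_leD; first exact: opnorm_leW (yu n.+1).
  rewrite e1; apply/opnorm_leN/opnorm_leZ; first by rewrite invr_ge0.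
  by apply: opnorm_leD; apply: opnorm_leM.
exists (1 - y); split.
- by rewrite adjB adj1 sy.
- have yy : y + y = b + y * y.
    rewrite -mulr2n -scaler_nat {1}fixy scalerA.
    by rewrite fmorphV rmorph_nat divff ?scale1r // pnatr_eq0.
  rewrite mulrBr mulr1 mulrBl mul1r opprB addrACA -opprD yy opprD addrACA.
  by rewrite subrr addr0 opprB addrC subrK.
- move=> c ca; rewrite mulrBr mulrBl mulr1 mul1r; congr (_ - _).
  have [k k0 ck] := bop_bound c.
  apply/eqP; rewrite -subr_eq0; apply/eqP; apply: (vanish _ (2 * k)) => [|n].
    by rewrite mulr_gt0.
  have cb : c * b = b * c.
    by rewrite mulrBr mulrBl mulr1 mul1r mulrA ca -mulrA ca mulrA.
  have -> : c * y - y * c = c * (y - u n) - (y - u n) * c.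
    rewrite mulrBr mulrBl opprB (sqrt_iter_comm n cb).
    by rewrite addrA subrK.
  have -> : 2 * k * d n = k * d n + d n * k by ring.
  apply: opnorm_leD; first by apply: opnorm_leM => //; exact: ltW.
  by apply: opnorm_leN; apply: opnorm_leM.
- move=> x; rewrite bopBE bop1E dotBl ReD ReN dotxx //=.
  rewrite subr_ge0; apply: le_trans (Re_le_modulus _) _.
  apply: le_trans (cauchy_schwarz Hdot _ _) _.
  by rewrite expr2 ler_wpM2r ?nrm_ge0 // -[X in _ <= X]mul1r; exact: y1.
Qed.

End SquareRoot.

(** * Uniform boundedness *)

Section UniformBoundedness.
Variables (R : realType) (H : completeNormedModType R[i]).

(** Gliding hump: each step moves the current point into the region where
    some member of the family is large, on a ball that the later steps do not
    leave. *)
Lemma uniform_boundedness (F : set (H -> R)) :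
  (forall f, F f -> [/\ forall x y, f (x + y) <= f x + f y,
     forall x, f (- x) = f x,
     forall (r : R) x, 0 <= r -> f (r%:C *: x) = r * f x &
     exists k, forall x, f x <= k * nrm x]) ->
  (forall x, exists k, forall f, F f -> f x <= k) ->
  exists k, forall f, F f -> forall x, f x <= k * nrm x.
Proof.
move=> Fseminorm Fpt.
have [//|/forallNP unbounded] :=
  pselect (exists k, forall f, F f -> forall x, f x <= k * nrm x).
have large k : exists f x, F f /\ k * nrm x < f x.
  have /existsNP[f /not_implyP[Ff /existsNP[x /negP]]] := unbounded k.
  by rewrite -ltNge => lt; exists f, x.
have step n (p : H * R) : exists q : H * R, 0 < p.2 ->
    [/\ nrm (q.1 - p.1) <= p.2, 0 < q.2, q.2 <= p.2 / 2 &
        exists2 f, F f & forall l, nrm (l - q.1) <= 2 * q.2 -> n%:R <= f l].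
  have [r0|] := pselect (0 < p.2); last by exists p.
  have [f [y [Ff fy]]] := large (2 * (n%:R + 1) / p.2).
  have [fD fN fZ [k0 fk0]] := Fseminorm _ Ff.
  have y0 : y != 0.
    apply/eqP => y0; move: fy (fk0 y).
    by rewrite y0 nrm0 !mulr0 => /lt_le_trans h /h; rewrite ltxx.
  have ny := nrm_gt0 y0.
  pose w := (p.2 / nrm y)%:C *: y.
  have rn0 : 0 <= p.2 / nrm y by rewrite divr_ge0 // ltW.
  have nw : nrm w = p.2 by rewrite nrmZr // divfK ?gt_eqF.
  have fw : 2 * (n%:R + 1) < f w.
    rewrite fZ //.
    have -> : 2 * (n%:R + 1) = p.2 / nrm y * (2 * (n%:R + 1) / p.2 * nrm y).
      by field; rewrite !gt_eqF.
    by rewrite ltr_pM2l ?divr_gt0.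
  have [x' [xx' fx']] : exists x', nrm (x' - p.1) <= p.2 /\ n%:R + 1 <= f x'.
    have [le|lt] := leP (n%:R + 1) (f p.1).
      by exists p.1; rewrite subrr nrm0 ltW.
    exists (p.1 + w); rewrite addrC addKr nw; split=> //.
    have := fD (p.1 + w) (- p.1); rewrite fN addrC addKr; lra.
  have [k k1 fk] : exists2 k, 0 < k & forall x, f x <= k * nrm x.
    exists (`|k0| + 1) => [|x]; first by rewrite ltr_wpDl.
    apply: le_trans (fk0 x) _; rewrite ler_wpM2r ?nrm_ge0 //.
    by have := ler_norm k0; lra.
  exists (x', Num.min (p.2 / 2) (2 * k)^-1) => _ /=; split=> //.
  - by rewrite lt_min divr_gt0 //= invr_gt0 mulr_gt0.
  - by rewrite ge_min lexx.
  exists f => // l lx.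
  have le : nrm (l - x') <= k^-1.
    apply: le_trans lx _.
    have -> : k^-1 = 2 * (2 * k)^-1 by field; rewrite gt_eqF.
    by rewrite ler_pM2l // ge_min lexx orbT.
  have := fk (l - x'); have := ler_wpM2l (ltW k1) le; rewrite divff ?gt_eqF //.
  have := fD l (x' - l); rewrite -(fN (l - x')) opprB addrC subrK; lra.
have [next nextP] : exists next : nat -> H * R -> H * R, forall n p, 0 < p.2 ->
    [/\ nrm ((next n p).1 - p.1) <= p.2, 0 < (next n p).2, (next n p).2 <= p.2 / 2 &
        exists2 f, F f & forall l, nrm (l - (next n p).1) <= 2 * (next n p).2 ->
          n%:R <= f l].
  exists (fun n => projT1 (choice (step n))) => n p.
  exact: (projT2 (choice (step n)) p).
pose s := fix s n := if n is m.+1 then next m (s m) else (0 : H, 1 : R).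
have spos n : 0 < (s n).2.
  elim: n => [|n IH]; first exact: ltr01.
  by have [] := nextP n _ IH.
have [l lP] : exists l, forall n, nrm (l - (s n).1) <= 2 * (s n).2.
  apply: (@geometric_limit _ _ (fun n => (s n).1) (fun n => (s n).2)) => n /=.
  - exact/ltW.
  - by have [] := nextP n _ (spos n).
  - by have [] := nextP n _ (spos n).
have [k kP] := Fpt l.
have [_ _ _ [f Ff]] := nextP (Num.truncn k).+1 _ (spos (Num.truncn k).+1).
move=> /(_ _ (lP (Num.truncn k).+2)); have := truncnS_gt k; have := kP _ Ff; lra.
Qed.

End UniformBoundedness.

(** * Projections in commutants *)

Section Commutant.
Variables (R : realType) (H : completeNormedModType R[i]).
Variables (dot : {dot H for @conjC R[i]}) (Hdot : induces_norm dot).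
Implicit Types (a b : bop H) (A : set (bop H)) (W V : set H).
Local Notation adj := (adj Hdot).

Definition comm A : set (bop H) := [set b | forall a, A a -> a * b = b * a].

Lemma comm_adj A : (forall a, A a -> A (adj a)) ->
  forall b, comm A b -> comm A (adj b).
Proof.
move=> adjA b bA a Aa; have := congr1 adj (bA _ (adjA _ Aa)).
by rewrite !adjM adjK.
Qed.

Lemma subspace_projection V : closed_subspace V ->
  exists q : bop H, [/\ adj q = q, forall x, V (q x), forall x, V x -> q x = x &
    forall a, (forall x, V x -> V (a x)) -> (forall x, V x -> V (adj a x)) ->
      a * q = q * a].
Proof.
move=> Vcl; have [V0 Vlin _] := Vcl.
have ex x : exists y, V y /\ forall w, V w -> dot (x - y) w = 0.
  by have [y Vy yP] := orthogonal_decomposition Hdot x Vcl; exists y.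
have [g gP] := choice ex.
have Vg x : V (g x) by case: (gP x).
have go x w : V w -> dot (x - g x) w = 0 by case: (gP x) => _; exact.
have VB x y : V x -> V y -> V (x - y).
  by move=> Vx Vy; rewrite addrC -scaleN1r; exact: Vlin.
have g_uniq x y : V y -> (forall w, V w -> dot (x - y) w = 0) -> g x = y.
  move=> Vy yo; apply/eqP; rewrite -subr_eq0; apply/eqP/(dotxx_eq0 Hdot).
  have -> : g x - y = (x - y) - (x - g x) by rewrite opprB [RHS]addrC addrA subrK.
  rewrite dotBl yo ?go ?subr0 //;
    rewrite opprB [X in V X]addrC addrA subrK; exact: VB.
have glin : linear g.
  move=> c x y; apply: g_uniq; first exact: Vlin.
  move=> w Vw; have -> : c *: x + y - (c *: g x + g y) =
      c *: (x - g x) + (y - g y) by rewrite scalerBr opprD addrACA.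
  by rewrite dotDl dotZl !go // mulr0 addr0.
have gself x y : dot (g x) y = dot x (g y).
  have e1 : dot (g x) (y - g y) = 0 by apply/dot_eq0C/go.
  have := go x _ (Vg y); move: e1; rewrite dotBl dotBr => /eqP.
  by rewrite subr_eq0 => /eqP -> /eqP; rewrite subr_eq0 => /eqP.
have gbd : bounded_map g.
  apply/bounded_mapP; exists 1 => // x; rewrite mul1r.
  have := nrm_sqrD Hdot (x - g x) (g x); rewrite subrK go //= mulr0 addr0 => e.
  by rewrite -(@ler_pXn2r R 2) ?nnegrE ?nrm_ge0 // e lerDr sqr_ge0.
exists (Bop glin gbd); split=> //=.
- exact: adj_uniq.
- by move=> x Vx; apply: g_uniq => // w _; rewrite subrr dot0l.
move=> a aV a'V; apply: bopP => x; rewrite !bopME /=.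
apply/esym/g_uniq; first exact: aV.
by move=> w Vw; rewrite -linearB adjP go //; exact: a'V.
Qed.

(** The projection onto the closed linear span of [W]. The span is described
    as the set of vectors killed by every bounded operator that kills [W]: this
    set is a closed subspace by definition, and inherits the invariance of
    [W]. *)
Lemma span_projection A W :
  (forall a, A a -> A (adj a)) -> (forall a x, A a -> W x -> W (a x)) ->
  exists q : bop H, [/\ adj q = q, comm A q, forall x, W x -> q x = x &
    forall b, (forall x, W x -> b x = 0) -> b * q = 0].
Proof.
move=> adjA AW.
pose V := [set v | forall b : bop H, (forall x, W x -> b x = 0) -> b v = 0].
have Vcl : closed_subspace V.
  split=> [b _|c x y Vx Vy b bW|x near b bW].
  - by rewrite linear0.
  - by rewrite linearP /= (Vx b bW) (Vy b bW) scaler0 addr0.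
  have [k k0 bk] := bop_bound b.
  apply: nrm0_eq0; apply/eqP; rewrite eq_le nrm_ge0 andbT.
  apply/ler_addgt0Pr => e e0; rewrite add0r.
  have [y Vy] := near _ (divr_gt0 e0 k0); rewrite ltr_pdivlMr // => lt.
  rewrite -[b x]subr0 -(Vy b bW) -linearB /=.
  by apply: le_trans (bk _) _; rewrite mulrC ltW.
have VA a x : A a -> V x -> V (a x).
  move=> Aa Vx b bW; rewrite -bopME; apply: Vx => y Wy.
  by rewrite bopME bW //; exact: AW.
have [q [sq qV Vq qcomm]] := subspace_projection Vcl.
exists q; split=> //.
- by move=> a Aa; apply: qcomm => x; apply: VA => //; exact: adjA.
- by move=> x Wx; apply: Vq => b; exact.
- by move=> b bW; apply: bopP => x; rewrite bopME; exact: qV.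
Qed.

End Commutant.

(** * Antilinear maps that intertwine an algebra with its commutant *)

Section Intertwining.
Variables (R : realType) (H : completeNormedModType R[i]).
Variables (dot : {dot H for @conjC R[i]}) (Hdot : induces_norm dot).
Local Notation adj := (adj Hdot).
Implicit Types (x y : bop H) (u v : H).

Variable M : set (bop H).
Local Notation M' := (comm M).
Hypothesis M_adj : forall x, M x -> M (adj x).
Hypothesis M_bicomm : forall x, comm M' x -> M x.

Variables (T Tinv : H -> H) (TK : cancel T Tinv) (TinvK : cancel Tinv T).
Hypothesis Tanti : antilinear T.

Variable th : bop H -> bop H.
Hypothesis th_M' : forall x, M x -> M' (th x).
Hypothesis th_onto : forall y, M' y -> exists2 x, M x & th x = y.
Hypothesis thE : forall x u, M x -> T (x u) = th x (T u).
Hypothesis th_centre : forall z, M z -> M' z -> th z = adj z.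

Lemma alg1 : M 1.
Proof. by apply: M_bicomm => y _; rewrite mulr1 mul1r. Qed.

Lemma algD x y : M x -> M y -> M (x + y).
Proof.
by move=> Mx My; apply: M_bicomm => c cM; rewrite mulrDr mulrDl -!cM.
Qed.

Lemma algZ c x : M x -> M (c *: x).
Proof.
by move=> Mx; apply: M_bicomm => y yM; rewrite -bop_scaleAr -bop_scaleAl -yM.
Qed.

Lemma algN x : M x -> M (- x).
Proof. by move=> Mx; rewrite -scaleN1r; exact: algZ. Qed.

Lemma algB x y : M x -> M y -> M (x - y).
Proof. by move=> Mx My; exact/algD/algN. Qed.

Lemma algM x y : M x -> M y -> M (x * y).
Proof.
by move=> Mx My; apply: M_bicomm => c cM; rewrite mulrA -cM // -mulrA -cM // mulrA.
Qed.

Lemma T_D u v : T (u + v) = T u + T v.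
Proof. by have := Tanti 1 u v; rewrite rmorph1 !scale1r. Qed.

Lemma T_0 : T 0 = 0.
Proof. by apply: (addrI (T 0)); rewrite -T_D !addr0. Qed.

Lemma T_Z c u : T (c *: u) = conjC c *: T u.
Proof. by have := Tanti c u 0; rewrite T_0 !addr0. Qed.

Lemma T_N u : T (- u) = - T u.
Proof. by rewrite -scaleN1r T_Z rmorphN rmorph1 scaleN1r. Qed.

Lemma nrmT_Zr (r : R) u : 0 <= r -> nrm (T (r%:C *: u)) = r * nrm (T u).
Proof. by move=> r0; rewrite T_Z conjC_real nrmZr. Qed.

Lemma th_uniq x y : M x -> (forall u, T (x u) = y (T u)) -> th x = y.
Proof. by move=> Mx xy; apply: bopP => u; rewrite -(TinvK u) -thE. Qed.

Lemma thM x y : M x -> M y -> th (x * y) = th x * th y.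
Proof.
by move=> Mx My; apply: th_uniq => [|u]; [exact: algM | rewrite !bopME !thE].
Qed.

Lemma thD x y : M x -> M y -> th (x + y) = th x + th y.
Proof.
by move=> Mx My; apply: th_uniq => [|u]; [exact: algD | rewrite !bopDE T_D !thE].
Qed.

Lemma thZ c x : M x -> th (c *: x) = conjC c *: th x.
Proof.
by move=> Mx; apply: th_uniq => [|u]; [exact: algZ | rewrite !bopZE T_Z thE].
Qed.

Lemma th1 : th 1 = 1.
Proof. by apply: th_uniq => //; exact: alg1. Qed.

Lemma th0 : th 0 = 0.
Proof.
apply: th_uniq => [|u]; last by rewrite !bop0E T_0.
by apply: M_bicomm => y _; rewrite mulr0 mul0r.
Qed.

Lemma th_eq0 x : M x -> th x = 0 -> x = 0.
Proof.
move=> Mx x0; apply: bopP => u; apply: (can_inj TK).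
by rewrite thE // x0 !bop0E T_0.
Qed.

Definition T_bounded x := bounded_map (T \o x).

Lemma T_unbounded_scaled x (k r : R) : ~ T_bounded x -> 0 < r ->
  exists2 u, nrm u <= r & k <= nrm (T (x u)).
Proof.
move=> Tx r0; pose K := `|k| + 1.
have K0 : 0 < K by rewrite ltr_wpDl.
have [u Ku] : exists u, K / r * nrm u < nrm (T (x u)).
  apply: contrapT => /forallNP no; apply: Tx; apply/bounded_mapP.
  exists (K / r) => [|u]; first exact: divr_gt0.
  by rewrite leNgt; apply/negP; exact: no.
have u0 : u != 0.
  apply/eqP => u0; move: Ku; rewrite u0 linear0 T_0 nrm0 mulr0.
  by rewrite ltxx.
have nu := nrm_gt0 u0; have ru : 0 < r / nrm u by exact: divr_gt0.
exists ((r / nrm u)%:C *: u).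
  by rewrite nrmZr ?(ltW ru) // divfK // gt_eqF.
rewrite linearZ /= nrmT_Zr ?(ltW ru) //.
apply: (@le_trans _ _ K); first by have := ler_norm k; rewrite /K; lra.
have -> : K = r / nrm u * (K / r * nrm u) by field; rewrite !gt_eqF.
by rewrite ler_pM2l // ltW.
Qed.

(** Gliding hump. Choose [w k] small with [T (a k (b k (w k)))] huge and sum
    the [b k (w k)]. Applying [a k] to the sum [l] leaves the [k]-th term and
    the terms before it, which the choice of [w k] accounts for; hence
    [th (a k) (T l) = T (a k l)] is too long for the vector [T l]. *)
Lemma triangular_bounded (a b : nat -> bop H) :
  (forall k, M (a k)) ->
  (forall k j, (k < j)%N -> a k * b j = 0) ->
  exists k, T_bounded (a k * b k).
Proof.
move=> Ma ab0; apply: contrapT => /forallNP unb.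
have /choice[K KP] : forall k, exists K,
    0 < K /\ forall u, nrm (th (a k) u) <= K * nrm u.
  by move=> k; have [K K0 KP] := bop_bound (th (a k)); exists K.
have pick k s : exists w, nrm (b k w) <= (2^-1) ^+ k /\
    k%:R * K k + nrm (T (a k s)) <= nrm (T (a k (b k w))).
  have [kb kb0 bkb] := bop_bound (b k).
  have p0 : 0 < (2^-1) ^+ k / kb :> R by rewrite divr_gt0 // exprn_gt0 // invr_gt0.
  have [w wr wT] := T_unbounded_scaled (k%:R * K k + nrm (T (a k s))) (unb k) p0.
  exists w; split=> //; apply: le_trans (bkb w) _.
  by rewrite mulrC -ler_pdivlMr.
have wP k := projT2 (choice (pick k)).
set w := fun k => projT1 (choice (pick k)) in wP.
pose s := fix s n := if n is m.+1 then s m + b m (w m (s m)) else 0.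
have [l lP] : exists l, forall n, nrm (l - s n) <= 2 * (2^-1) ^+ n.
  apply: geometric_limit => n /=.
  - by rewrite exprn_ge0 // invr_ge0.
  - by rewrite addrC addKr; case: (wP n (s n)).
  - by rewrite exprS mulrC.
have tail k m : a k (s (k.+1 + m)%N) = a k (s k.+1).
  elim: m => [|m IH]; first by rewrite addn0.
  rewrite addnS /= linearD /= IH -bopME ab0 ?bop0E ?addr0 //.
  by rewrite ltnS leq_addr.
have al k : a k l = a k (s k.+1).
  apply/eqP; rewrite -subr_eq0; apply/eqP/nrm0_eq0/eqP.
  rewrite eq_le nrm_ge0 andbT.
  have [ka ka0 aka] := bop_bound (a k).
  apply: (@le_from_half_powers _ _ _ (ka * 2)) => n; rewrite add0r.
  rewrite -(tail k n) -linearB; apply: le_trans (aka _) _.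
  rewrite -mulrA ler_wpM2l ?(ltW ka0) //; apply: le_trans (lP _) _.
  rewrite ler_wpM2l // ler_wiXn2l ?invr_ge0 ?leq_addl //.
  by rewrite invf_le1 // ler1n.
have big k : k%:R <= nrm (T l).
  have [K0 bK] := KP k; have [_ low] := wP k (s k).
  rewrite -(ler_pM2l K0); apply: le_trans (bK _).
  rewrite -thE // al /= linearD T_D /=.
  have := nrmB (T (a k (s k)) + T (a k (b k (w k (s k))))) (T (a k (s k))).
  by rewrite [X in nrm (X - _)]addrC addrK; lra.
by have := truncnS_gt (nrm (T l)); have := big (Num.truncn (nrm (T l))).+1; lra.
Qed.

Lemma M'_adj y : M' y -> M' (adj y).
Proof. by move=> yM; exact: comm_adj. Qed.

Definition central_projection z := [/\ M z, M' z, adj z = z & z * z = z].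

(** The closed linear span of [M W] is invariant under both [M] and [M'], so
    the projection onto it is central. *)
Lemma central_cover (W : set H) :
  (forall y u, M' y -> W u -> W (y u)) ->
  exists z : bop H, [/\ central_projection z, forall u, W u -> z u = u &
    forall b : bop H, (forall m u, M m -> W u -> b (m u) = 0) -> b * z = 0].
Proof.
move=> WM'.
pose MW := [set v | exists m u, [/\ M m, W u & v = m u]].
have adjA x : (M `|` M') x -> (M `|` M') (adj x).
  by move=> [Mx|M'x]; [left; exact: M_adj | right; exact: M'_adj].
have inv x v : (M `|` M') x -> MW v -> MW (x v).
  move=> [Mx|M'x] [m [u [Mm Wu ->]]].
    by exists (x * m), u; split=> //; exact: algM.
  by exists m, (x u); split=> //; [exact: WM' | rewrite -!bopME M'x].
have [z [sz zcomm zMW zkill]] := span_projection adjA inv.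
have zkill' (b : bop H) : (forall m u, M m -> W u -> b (m u) = 0) -> b * z = 0.
  by move=> bMW; apply: zkill => v [m [u [Mm Wu ->]]]; exact: bMW.
have zW m u : M m -> W u -> z (m u) = m u.
  by move=> Mm Wu; apply: zMW; exists m, u.
exists z; split=> //; last by move=> u Wu; exact: (zW 1 u alg1).
split=> //.
- by apply: M_bicomm => y yM; apply: zcomm; right.
- by move=> y My; apply: zcomm; left.
apply/esym/eqP; rewrite -subr_eq0 -[X in X - _]mul1r -mulrBl; apply/eqP/zkill'.
by move=> m u Mm Wu; rewrite bopBE bop1E zW ?subrr.
Qed.

Lemma th_central_projection z : central_projection z -> th z = z.
Proof. by move=> [Mz M'z sz _]; rewrite th_centre. Qed.

(** The domain of the adjoint of [T]. *)
Definition dom_adj : set H :=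
  [set v | exists k : R, forall u, modulus (dot (T u) v) <= k * nrm u].

(** The closed graph theorem in the form used here: the functionals
    [dot (T _) v] for unit vectors [v] of [dom_adj] are pointwise bounded by
    [nrm (T u)], hence uniformly bounded, and this makes [dom_adj] closed. *)
Lemma dense_dom_adj_bounded :
  (forall u, (forall v, dom_adj v -> dot u v = 0) -> u = 0) -> bounded_map T.
Proof.
move=> dense.
pose F := [set f | exists2 v, dom_adj v &
  f = (fun u => modulus (dot (T u) v) / nrm v)].
have [k kP] : exists k : R, forall f, F f -> forall u, f u <= k * nrm u.
  apply: uniform_boundedness => [_ [v [k vk] ->]|u].
    have iv : 0 <= (nrm v)^-1 by rewrite invr_ge0 nrm_ge0.
    split=> [x y|x|r x r0|].
    - by rewrite -mulrDl ler_wpM2r // T_D dotDl modulusD.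
    - by rewrite T_N -scaleN1r dotZl modulusM {1}/modulus normrN1 mul1r.
    - by rewrite T_Z conjC_real dotZl modulusM modulus_real // mulrA.
    - by exists (k / nrm v) => x; rewrite mulrAC ler_wpM2r.
  exists (nrm (T u)) => _ [v _ ->].
  have [->|v0] := eqVneq v 0; first by rewrite dot0r modulus0 mul0r nrm_ge0.
  by rewrite ler_pdivrMr ?nrm_gt0 //; exact: cauchy_schwarz.
pose k1 := `|k| + 1.
have k10 : 0 < k1 by rewrite ltr_wpDl.
have bound u v : dom_adj v -> modulus (dot (T u) v) <= k1 * nrm u * nrm v.
  move=> Dv; have [->|v0] := eqVneq v 0.
    by rewrite dot0r modulus0 nrm0 mulr0.
  rewrite -ler_pdivrMr ?nrm_gt0 //.
  apply: (@le_trans _ _ (k * nrm u)); first by apply: (kP (fun u => _)); exists v.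
  by rewrite ler_wpM2r ?nrm_ge0 // /k1; have := ler_norm k; lra.
have Dcl : closed_subspace dom_adj.
  split=> [|c x y [a ax] [b bx]|x near].
  - by exists 0 => u; rewrite dot0r modulus0 mul0r.
  - exists (modulus c * a + b) => u.
    rewrite dotDr dotZr; apply: le_trans (modulusD _ _) _.
    rewrite modulusM modulusJ mulrDl -mulrA lerD //.
    by rewrite ler_wpM2l ?modulus_ge0.
  exists (k1 * nrm x) => u; apply/ler_addgt0Pr => e e0.
  pose c := k1 * nrm u + nrm (T u) + 1.
  have c0 : 0 < c by rewrite ltr_wpDl // addr_ge0 ?mulr_ge0 ?nrm_ge0 // ltW.
  have [y Dy] := near _ (divr_gt0 e0 c0); rewrite ltr_pdivlMr // => xy.
  have -> : dot (T u) x = dot (T u) y + dot (T u) (x - y).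
    by rewrite -dotDr addrC subrK.
  apply: le_trans (modulusD _ _) _.
  apply: le_trans (lerD (bound u y Dy) (cauchy_schwarz Hdot _ _)) _.
  have : nrm y <= nrm x + nrm (x - y).
    by have := nrmB x (x - y); rewrite subKr.
  have := nrm_ge0 (x - y); have := nrm_ge0 (T u).
  have := mulr_ge0 (ltW k10) (nrm_ge0 u); rewrite /c in xy c0.
  rewrite (mulrAC k1 (nrm x)).
  move: (k1 * nrm u) (nrm (T u)) (nrm (x - y)) (nrm x) (nrm y) xy => p q r s t.
  nra.
have full v : dom_adj v.
  have [y Dy ort] := orthogonal_decomposition Hdot v Dcl.
  by have /eqP := dense _ ort; rewrite subr_eq0 => /eqP ->.
apply/bounded_mapP; exists k1 => // u.
have [->|Tu0] := eqVneq (T u) 0; first by rewrite nrm0 mulr_ge0 ?nrm_ge0 // ltW.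
rewrite -(ler_pM2r (nrm_gt0 Tu0)); apply: le_trans (bound u (T u) (full _)).
by rewrite (dotxx Hdot) modulus_real ?sqr_ge0 // expr2.
Qed.

(** The projection [z] covers the orthogonal complement of [dom_adj], where
    the discontinuity of [T] is concentrated: if [T x] is bounded then [th x]
    kills this complement. *)
Lemma discontinuity_projection : ~ bounded_map T ->
  exists z, [/\ central_projection z, z != 0 &
    forall x, M x -> T_bounded x -> x * z = 0].
Proof.
move=> Tunb; pose S := [set u | forall v, dom_adj v -> dot u v = 0].
have [s Ss s0] : exists2 s, S s & s != 0.
  apply: contrapT => /forall2NP no; apply: Tunb; apply: dense_dom_adj_bounded.
  by move=> u Su; have [//|/negP] := no u; rewrite negbK => /eqP.
have SM' y u : M' y -> S u -> S (y u).
  move=> /th_onto[x Mx <-] Su v [k vk]; rewrite adjP; apply: Su.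
  have [l l0 xl] := bop_bound x; exists (`|k| * l) => w.
  rewrite -adjP -thE //; apply: le_trans (vk _) _.
  rewrite -mulrA; apply: (@le_trans _ _ (`|k| * nrm (x w))).
    by rewrite ler_wpM2r ?nrm_ge0 // ler_norm.
  by rewrite ler_wpM2l.
have [z [cz zS zkill]] := central_cover SM'.
exists z; split=> // [|x Mx /bounded_mapP[k k0 xk]].
  by apply: contraNneq s0 => z0; rewrite -(zS s Ss) z0 bop0E.
have thxS u : S u -> th x u = 0.
  move=> Su; apply: (dot_inj Hdot) => v; rewrite adjP; apply: Su.
  exists (k * nrm v) => w; rewrite -adjP -thE //.
  apply: le_trans (cauchy_schwarz Hdot _ _) _.
  by rewrite mulrAC ler_wpM2r ?nrm_ge0 //; exact: xk.
have [Mz _ _ _] := cz.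
apply: th_eq0; first exact: algM.
rewrite thM // (th_central_projection cz); apply: zkill => m u Mm Su.
by rewrite -bopME -(th_M' Mx) // bopME thxS // linear0.
Qed.

(** * A minimal projection *)

Section MinimalProjection.
Variable z : bop H.
Hypotheses (cz : central_projection z) (z0 : z != 0).
Hypothesis T_bounded_z : forall x, M x -> T_bounded x -> x * z = 0.

(** The left annihilators of the right multiples of [g] are compared, in place
    of the right ideals themselves: this is the form of chain condition that
    triangular systems provide. *)
Definition annihilator_minimal (g : bop H) :=
  forall c w, M c -> M w -> g * c != 0 -> w * (g * c) = 0 -> w * g = 0.

(** Otherwise, passing to right multiples enlarges the left annihilator
    forever, and the annihilating elements form a triangular system. *)
Lemma annihilator_minimal_exists :
  exists g, [/\ M g, g * z = g, g != 0 & annihilator_minimal g].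
Proof.
have [Mz M'z _ zz] := cz.
apply: contrapT => /forallNP no.
have grow b : exists p : bop H * bop H, [/\ M b, b * z = b & b != 0] ->
    [/\ M p.1, M p.2, b * p.1 != 0, p.2 * (b * p.1) = 0 & p.2 * b != 0].
  have [[Mb bz b0]|] := pselect [/\ M b, b * z = b & b != 0]; last by exists (0, 0).
  have nomin : ~ annihilator_minimal b by move=> min; apply: (no b); split.
  move/existsNP: nomin => [c /existsNP[w]].
  move=> /not_implyP[Mc /not_implyP[Mw /not_implyP[bc /not_implyP[wbc /eqP wb]]]].
  by exists (c, w).
have [f fP] := choice grow.
pose B := fix B n := if n is m.+1 then B m * (f (B m)).1 else z.
have BP n : [/\ M (B n), B n * z = B n & B n != 0].
  elim: n => [|n IH] //=; have [Mc _ Bc _ _] := fP _ IH; have [algB Bz _] := IH.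
  by split=> //; [exact: algM | rewrite -mulrA M'z // mulrA Bz].
pose a k := (f (B k)).2.
have Ma k : M (a k) by have [_] := fP _ (BP k).
have aB k j : (k < j)%N -> a k * B j = 0.
  move=> /subnKC <-; elim: (j - k.+1)%N => [|m IH].
    by rewrite addn0 /=; have [_ _ _] := fP _ (BP k).
  by rewrite addnS /= mulrA IH mul0r.
have [k bounded] := triangular_bounded Ma aB.
have [algB Bz _] := BP k; have [_ _ _ _ /eqP[]] := fP _ (BP k).
by have := T_bounded_z (algM (Ma k) algB) bounded; rewrite -mulrA Bz.
Qed.

Lemma selfadjoint_annihilator_minimal_exists :
  exists g, [/\ M g, adj g = g, g * z = g, g != 0 & annihilator_minimal g].
Proof.
have [Mz M'z _ _] := cz.
have [b [Mb bz b0 bmin]] := annihilator_minimal_exists.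
exists (b * adj b); split.
- exact/algM/M_adj.
- by rewrite adjM adjK.
- by rewrite -mulrA M'z ?mulrA ?bz //; exact: M_adj.
- apply: contra_neq b0 => bb; rewrite -[b](adjK Hdot).
  have -> : adj b = 0 by apply: (@adj_mul_eq0 _ _ _ Hdot); rewrite adjK.
  by apply: adj_uniq => u v; rewrite dot0l dot0r.
move=> c w Mc Mw; rewrite -!mulrA => bbc wbbc; rewrite mulrA.
by rewrite (bmin (adj b * c) w) ?mul0r //; exact/algM/Mc/M_adj.
Qed.

Section Corner.
Variable g : bop H.
Hypotheses (Mg : M g) (sg : adj g = g) (g0 : g != 0).
Hypothesis gmin : annihilator_minimal g.

(** With [s] the absolute value of [a], one of the factors of
    [(s - a) * (s + a) = 0] vanishes because [g] is minimal. *)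
Lemma corner_semidefinite x : M x -> adj (g * x * g) = g * x * g ->
  (forall u, 0 <= complex.Re (dot ((g * x * g) u) u)) \/
  (forall u, complex.Re (dot ((g * x * g) u) u) <= 0).
Proof.
move=> Mx sx; have [k k0 kP] := bop_bound (g * x * g).
have ki0 : 0 <= k^-1 by rewrite invr_ge0 ltW.
pose x' := (k^-1)%:C *: x; pose a := g * x' * g.
have Mx' : M x' by exact: algZ.
have Ma : M a by exact/algM/Mg/algM.
have aE : a = (k^-1)%:C *: (g * x * g).
  by rewrite /a /x' -bop_scaleAr -bop_scaleAl.
have sa : adj a = a by rewrite aE adjZ sx conjC_real.
have a1 : opnorm_le a 1.
  rewrite aE -(mulVf (lt0r_neq0 k0)); exact: opnorm_leZ.
have [s [ss s2 scomm spos]] := contraction_abs sa a1.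
have Ms : M s.
  by apply: M_bicomm => y yM; apply: scomm; rewrite (yM _ Ma).
have sas : a * s = s * a by exact: scomm.
have kE u : complex.Re (dot ((g * x * g) u) u) = k * complex.Re (dot (a u) u).
  rewrite aE bopZE dotZl ReZ mulrA divff ?mul1r // gt_eqF //.
have prod0 : (s - a) * (s + a) = 0.
  by rewrite mulrBl !mulrDr s2 sas [s * a + _]addrC subrr.
have [as0|as0] := eqVneq (a * (s + a)) 0.
  right=> u; rewrite kE pmulr_rle0 //.
  have da : (s + a) * a = 0 by rewrite mulrDl -sas -mulrDr.
  have ds : (s + a) * s = 0 by rewrite mulrDl s2 sas addrC -mulrDl.
  have /eqP : s + a = 0.
    apply: (selfadjoint_sqr_eq0 (Hdot := Hdot)); first by rewrite adjD ss sa.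
    by rewrite mulrDr da ds addr0.
  rewrite addrC addr_eq0 => /eqP ->; rewrite bopNE -scaleN1r dotZl mulN1r ReN.
  by rewrite oppr_le0.
left=> u; rewrite kE pmulr_rge0 //.
have dg : (s - a) * g = 0.
  apply: (gmin (c := x' * g * (s + a))).
  - exact/algM/algD/Ma/Ms/algM.
  - exact: algB.
  - by rewrite !mulrA.
  have -> : g * (x' * g * (s + a)) = a * (s + a) by rewrite !mulrA.
  by rewrite mulrA mulrBl -sas -mulrBr -mulrA prod0 mulr0.
have da : (s - a) * a = 0 by rewrite /a !mulrA dg !mul0r.
have ds : (s - a) * s = 0 by rewrite mulrBl s2 sas -opprB -mulrBl da oppr0.
have /eqP : s - a = 0.
  apply: (selfadjoint_sqr_eq0 (Hdot := Hdot)); first by rewrite adjB ss sa.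
  by rewrite mulrBr da ds subrr.
by rewrite subr_eq0 => /eqP <-.
Qed.

(** Polarization at the vectors [u] and [d u]. *)
Lemma selfadjoint_form_eq0 d : adj d = d ->
  (forall u, complex.Re (dot (d u) u) = 0) -> d = 0.
Proof.
move=> sd q0; apply: bopP => u; apply: (dotxx_eq0 Hdot).
have := q0 (u + d u); rewrite (linearD d) /= dotDl !dotDr !ReD !q0.
have -> : dot (d (d u)) u = dot (d u) (d u) by rewrite adjP sd.
by rewrite (dotxx Hdot) /= => e; congr (_%:C); lra.
Qed.

(** Every combination [a - t * g ^ 2] is semidefinite, so the quadratic forms
    of [a] and [g ^ 2] are proportional. *)
Lemma corner_selfadjoint_scalar x : M x -> adj (g * x * g) = g * x * g ->
  exists t : R, g * x * g = t%:C *: (g * g).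
Proof.
move=> Mx sx; pose q u := complex.Re (dot ((g * x * g) u) u).
pose n u := nrm (g u) ^+ 2.
have n0 u : 0 <= n u by exact: sqr_ge0.
have qE (t : R) u :
    complex.Re (dot ((g * (x - t%:C *: (1 : bop H)) * g) u) u) = q u - t * n u.
  have -> : g * (x - t%:C *: (1 : bop H)) * g = g * x * g - t%:C *: (g * g).
    by rewrite mulrBr mulrBl -bop_scaleAr mulr1 -bop_scaleAl.
  rewrite bopBE dotBl ReD ReN bopZE dotZl ReZ bopME; congr (_ - _ * _).
  by rewrite (adjP Hdot g) sg (dotxx Hdot).
have alt (t : R) : (forall u, t * n u <= q u) \/ (forall u, q u <= t * n u).
  have sxt : adj (g * (x - t%:C *: (1 : bop H)) * g) = g * (x - t%:C *: (1 : bop H)) * g.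
    rewrite mulrBr mulrBl adjB sx -bop_scaleAr -bop_scaleAl adjZ conjC_real.
    by rewrite mulr1 adjM sg.
  have Mxt : M (x - t%:C *: (1 : bop H)) by apply/algB/algZ/alg1.
  have [h|h] := corner_semidefinite Mxt sxt; [left|right] => u.
    by have := h u; rewrite qE subr_ge0.
  by have := h u; rewrite qE subr_le0.
have [u0 nu0] : exists u, 0 < n u.
  apply: contrapT => /forallNP no; move/eqP: g0; apply; apply: bopP => u.
  apply/nrm0_eq0/eqP; rewrite -sqrf_eq0 eq_le sqr_ge0 andbT leNgt.
  exact/negP/no.
pose t0 := q u0 / n u0.
have q0E : q u0 = t0 * n u0 by rewrite divfK // gt_eqF.
have step (e : R) u : 0 < e -> q u <= (t0 + e) * n u /\ (t0 - e) * n u <= q u.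
  move=> e0; split.
    by have [h|//] := alt (t0 + e); have := h u0; rewrite q0E; nra.
  by have [//|h] := alt (t0 - e); have := h u0; rewrite q0E; nra.
have qn u : q u = t0 * n u.
  apply/eqP; rewrite eq_le; apply/andP; split; apply/ler_addgt0Pr => e e0.
    have c0 : 0 < n u + 1 by rewrite ltr_wpDl.
    have [h _] := step _ u (divr_gt0 e0 c0); apply: le_trans h _.
    rewrite mulrDl lerD2l mulrAC ler_pdivrMr // ler_wpM2l ?(ltW e0) //; lra.
  have c0 : 0 < n u + 1 by rewrite ltr_wpDl.
  have [_ h] := step _ u (divr_gt0 e0 c0).
  have : e / (n u + 1) * n u <= e.
    by rewrite mulrAC ler_pdivrMr // ler_wpM2l ?(ltW e0) //; lra.
  lra.
exists t0; apply/eqP; rewrite -subr_eq0; apply/eqP.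
apply: selfadjoint_form_eq0.
  by rewrite adjB sx adjZ conjC_real adjM sg.
move=> u; rewrite bopBE dotBl ReD ReN bopZE dotZl ReZ bopME (adjP Hdot g (g u)) sg.
by rewrite (dotxx Hdot) -/(q u) qn /= subrr.
Qed.

(** Real and imaginary parts reduce this to the self-adjoint case. *)
Lemma corner_scalar x : M x -> exists c : R[i], g * x * g = c *: (g * g).
Proof.
move=> Mx; pose i : R[i] := 'i%C.
have ii : i * i = -1 by rewrite -expr2 sqr_i.
have Ji : conjC i = - i by apply/eqP; rewrite eq_complex /= oppr0 !eqxx.
pose x1 := x + adj x; pose x2 := i *: (x - adj x).
have Mx1 : M x1 by exact/algD/M_adj.
have Mx2 : M x2 by exact/algZ/algB/M_adj.
have s1 : adj (g * x1 * g) = g * x1 * g.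
  by rewrite !adjM sg /x1 adjD adjK [adj x + _]addrC mulrA.
have s2 : adj (g * x2 * g) = g * x2 * g.
  rewrite !adjM sg /x2 adjZ adjB adjK Ji scaleNr -scalerN opprB mulrA.
  by [].
have [t1 e1] := corner_selfadjoint_scalar Mx1 s1.
have [t2 e2] := corner_selfadjoint_scalar Mx2 s2.
exists ((2^-1 : R[i]) * (t1%:C - i * t2%:C)).
rewrite -scalerA scalerBl -scalerA -e1 -e2.
have -> : x = (2^-1 : R[i]) *: (x1 - i *: x2).
  rewrite /x2 scalerA ii scaleN1r opprK /x1 addrACA subrr addr0.
  by rewrite -mulr2n -(scaler_nat 2 x) scalerA mulVf ?scale1r // pnatr_eq0.
by rewrite -!(bop_scaleAr, bop_scaleAl) mulrBr mulrBl -!(bop_scaleAr, bop_scaleAl).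
Qed.

End Corner.

(** For [x = g] the scalar corner gives [g ^ 3 = c * g ^ 2], so [g] is a
    multiple of a projection. *)
Lemma minimal_projection_exists : exists e,
  [/\ M e, adj e = e, e * e = e, e * z = e /\ e != 0 &
      forall x, M x -> exists c : R[i], e * x * e = c *: e].
Proof.
have [g [Mg sg gz g0 gmin]] := selfadjoint_annihilator_minimal_exists.
have sggg : adj (g * g * g) = g * g * g by rewrite !adjM sg mulrA.
have [t tE] := corner_selfadjoint_scalar Mg sg g0 gmin Mg sggg.
have gg : g * g = t%:C *: g.
  apply/eqP; rewrite -subr_eq0; apply/eqP.
  have gh : g * (g * g - t%:C *: g) = 0.
    by rewrite mulrBr mulrA tE -bop_scaleAr subrr.
  apply: (selfadjoint_sqr_eq0 (Hdot := Hdot)).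
    by rewrite adjB adjM adjZ sg conjC_real.
  by rewrite {1}mulrBl -mulrA gh -bop_scaleAl gh mulr0 scaler0 subrr.
have t0 : t%:C != 0 :> R[i].
  apply: contra_neq g0 => t0; apply: (selfadjoint_sqr_eq0 sg).
  by rewrite gg t0 scale0r.
pose r : R[i] := (t%:C)^-1.
have rt : r * t%:C = 1 by rewrite mulVf.
have ee : (r *: g) * (r *: g) = r *: g.
  by rewrite -bop_scaleAl -bop_scaleAr gg !scalerA -mulrA rt mulr1.
exists (r *: g); split=> //.
- exact: algZ.
- by rewrite adjZ sg /r -fmorphV conjC_real.
- split; first by rewrite -bop_scaleAl gz.
  by rewrite scaler_eq0 negb_or invr_eq0 t0.
move=> x Mx; have [c cE] := corner_scalar Mg sg g0 gmin Mx; exists c.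
rewrite -[in RHS]ee -!(bop_scaleAl, bop_scaleAr) cE.
by rewrite !scalerA; congr (_ *: _); rewrite mulrC mulrA.
Qed.

End MinimalProjection.

(** * The range of a minimal projection *)

Section MinimalRange.
Variable e : bop H.
Hypotheses (Me : M e) (se : adj e = e) (ee : e * e = e) (e0 : e != 0).
Hypothesis e_corner : forall x, M x -> exists c : R[i], e * x * e = c *: e.
Local Notation f := (th e).

Lemma f_M' : M' f. Proof. exact: th_M'. Qed.

Lemma f_idem : f * f = f. Proof. by rewrite -thM // ee. Qed.

Lemma f_corner y : M' y -> exists c : R[i], f * y * f = c *: f.
Proof.
move=> /th_onto[x Mx <-]; have [c cE] := e_corner Mx; exists (conjC c).
by rewrite -!thM ?cE ?thZ //; exact: algM.
Qed.

Lemma e_central_cover : exists z, [/\ central_projection z, z * e = e &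
  forall b : bop H, (forall m, M m -> b * m * e = 0) -> b * z = 0].
Proof.
have inv y u : M' y -> range e u -> range e (y u).
  by move=> M'y [v _ <-]; exists (y v) => //; rewrite -!bopME M'y.
have [z [cz ze zkill]] := central_cover inv.
exists z; split=> //.
  by apply: bopP => u; rewrite bopME ze //; exists u.
move=> b be; apply: zkill => m _ Mm [u _ <-].
by rewrite -!bopME ?mulrA be // bop0E.
Qed.

(** The central cover of [e] is fixed by [th], so [f] and [e] have the same
    central cover and cannot be disjoint. *)
Lemma fe_neq0 : f * e != 0.
Proof.
have [z [cz ze zkill]] := e_central_cover; have [Mz _ _ _] := cz.
apply: contra_neq e0 => fe; apply: (th_eq0 Me).
have fz : f * z = 0.
  by apply: zkill => m Mm; rewrite -(f_M' Mm) -mulrA fe mulr0.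
by rewrite -[in LHS]ze thM // (th_central_projection cz) (f_M' Mz).
Qed.

(** [w] kills the central cover [z] of [e]; since [th] fixes [z], so does
    [th w]. *)
Lemma th_kill w : M w -> (forall m, M m -> w * m * e = 0) -> th w * e = 0.
Proof.
move=> Mw we; have [z [cz ze zkill]] := e_central_cover.
have [Mz _ _ _] := cz.
rewrite -[in LHS]ze mulrA -[z in LHS](th_central_projection cz) -thM //.
by rewrite zkill // th0 mul0r.
Qed.

(** [M'] acts irreducibly on the range of [e]: the projection onto the closed
    span of [M' u] lies in the corner [e M e], which is scalar, so it is [e]. *)
Lemma e_irreducible (u : H) (b : bop H) : e u = u -> u != 0 ->
  (forall y, M' y -> b (y u) = 0) -> b * e = 0.
Proof.
move=> eu u0 bu.
pose W := [set v | exists2 y, M' y & v = y u].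
have M'M' x y : M' x -> M' y -> M' (x * y).
  by move=> M'x M'y m Mm; rewrite mulrA M'x // -!mulrA M'y.
have WM' x v : M' x -> W v -> W (x v).
  by move=> M'x [y M'y ->]; exists (x * y) => //; exact: M'M'.
have [q [sq qcomm qW qkill]] := span_projection M'_adj WM'.
have Mq : M q by exact: M_bicomm.
have qu : q u = u by apply: qW; exists 1 => // m _; rewrite mulr1 mul1r.
have eq : e * q = q.
  apply/esym/eqP; rewrite -subr_eq0 -[X in X - _]mul1r -mulrBl; apply/eqP.
  apply: qkill => _ [y M'y ->].
  by rewrite bopBE bop1E -bopME M'y // bopME eu subrr.
have qe : q * e = q by have := congr1 adj eq; rewrite adjM sq se.
have [c cE] := e_corner Mq.
have qE : q = c *: e by rewrite -cE eq qe.
have c1 : c = 1.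
  apply/eqP; rewrite -subr_eq0; apply: contraT => c1.
  have := qu; rewrite {1}qE bopZE eu => /eqP.
  by rewrite -subr_eq0 -{2}[u]scale1r -scalerBl scaler_eq0 (negPf c1) (negPf u0).
have -> : e = q by rewrite qE c1 scale1r.
by apply: qkill => _ [y M'y ->]; exact: bu.
Qed.

(** On the range of [e] the operators [f y] with [y] in [M'] only see the line
    of [v], by minimality of [f]; irreducibility then confines [f * e] to this
    line. *)
Lemma fe_rank_one : exists2 v : H, v != 0 &
  forall u, exists c : R[i], f (e u) = c *: v.
Proof.
have [u0 v0] : exists u, f (e u) != 0.
  apply: contrapT => /forallNP no; move/eqP: fe_neq0; apply; apply: bopP => u.
  by rewrite bopME; apply/eqP/negbNE/negP/no.
set v := f (e u0) in v0; exists v => //.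
have ev : e v = v by rewrite /v -bopME (f_M' Me) bopME -[e (e _)]bopME ee.
have fv : f v = v by rewrite /v -[f (f _)]bopME f_idem.
have nv : dot v v != 0 by apply: contra_neq v0; exact: dotxx_eq0.
pose r w := w - (dot w v / dot v v) *: v.
have rlin : linear r.
  move=> c w w'; rewrite /r dotDl dotZl mulrDl scalerDl opprD addrACA.
  by rewrite scalerBr scalerA mulrA.
have rbd : bounded_map r.
  apply/bounded_mapP; exists 1 => // w; rewrite mul1r.
  have ort : dot (r w) v = 0 by rewrite dotBl dotZl divfK ?subrr.
  have := nrm_sqrD Hdot (r w) ((dot w v / dot v v) *: v).
  rewrite subrK dotZr ort mulr0 /= mulr0 addr0 => wE.
  by rewrite -(@ler_pXn2r R 2) ?nnegrE ?nrm_ge0 // wE lerDl sqr_ge0.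
pose b : bop H := Bop rlin rbd.
have rv c : b (c *: v) = 0.
  by rewrite /= /r dotZl mulfK // subrr.
have bfe : b * f * e = 0.
  apply: (e_irreducible ev v0) => y M'y.
  have [c cE] := f_corner M'y.
  have -> : (b * f) (y v) = b ((f * y * f) v) by rewrite !bopME fv.
  by rewrite cE bopZE fv rv.
move=> u; exists (dot (f (e u)) v / dot v v); apply/eqP; rewrite -subr_eq0.
by have := congr1 (fun a : bop H => a u) bfe; rewrite !bopME /= /r => ->.
Qed.

(** [T (th (x * e * r)) e = T (th x) f (th r) e], where the middle factor
    [f * e] has rank one. *)
Lemma T_bounded_through_e x r : M x -> M r ->
  bounded_map (fun u => T (th (x * e * r) (e u))).
Proof.
move=> Mx Mr; have [v v0 vP] := fe_rank_one.
have nv := nrm_gt0 v0.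
have [k k0 kP] := bop_bound (f * e * th r).
apply/bounded_mapP; exists (k / nrm v * (nrm (T (th x v)) + 1)) => [|u].
  by rewrite mulr_gt0 ?divr_gt0 // ltr_wpDl ?nrm_ge0.
have -> : th (x * e * r) (e u) = th x ((f * e * th r) u).
  rewrite !thM //; last exact: algM.
  by rewrite !bopME -[th r (e u)]bopME -(th_M' Mr Me).
have := kP u; rewrite !bopME; have [c ->] := vP (th r u).
rewrite nrmZ linearZ /= T_Z nrmZ modulusJ => ck.
have cle : modulus c <= k / nrm v * nrm u.
  by rewrite mulrAC ler_pdivlMr.
have := ler_wpM2r (nrm_ge0 (T (th x v))) cle.
have := le_trans (modulus_ge0 c) cle.
by rewrite mulrDr mulr1 mulrDl mulrAC; lra.
Qed.

(** Gram-Schmidt in the left ideal [M e], with the inner product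
    [(x, y) |-> e y^* x e] whose values are scalars: [w] is the projection onto
    the complement of the elements found so far. The process stops because
    an infinite orthogonal system would be triangular. *)
Lemma finite_orthogonal_system :
  (exists z, [/\ e * z = e & forall x, M x -> T_bounded x -> x * z = 0]) ->
  exists w, [/\ M w, bounded_map (fun u => T (th (1 - w) (e u))) &
    forall m, M m -> w * m * e = 0].
Proof.
move=> [z [ez Tz]]; apply: contrapT => /forallNP no.
pose Q w := M w /\ bounded_map (fun u => T (th (1 - w) (e u))).
have extend w : exists p : bop H * R[i], Q w -> exists x,
    [/\ M x, p.1 = w * x * e, p.1 != 0 & adj p.1 * p.1 = p.2 *: e].
  have [[Mw bw]|] := pselect (Q w); last by exists (0, 0).
  have /existsNP[x /not_implyP[Mx /eqP wx]] :
      ~ (forall m, M m -> w * m * e = 0) by move=> h; apply: (no w); split.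
  have [c cE] := e_corner (algM (M_adj (algM Mw Mx)) (algM Mw Mx)).
  exists (w * x * e, c) => _; exists x; split=> //=.
  by rewrite adjM se -cE !mulrA.
have [p pP] := choice extend.
pose next w := w - (p w).2^-1 *: ((p w).1 * adj (p w).1 * w).
pose W := fix W n := if n is m.+1 then next (W m) else 1.
have c_neq0 w : Q w -> (p w).2 != 0.
  move=> /pP[x [_ _ m0 mm]]; apply: contra_neq m0 => c0.
  by apply: (@adj_mul_eq0 _ _ _ Hdot); rewrite mm c0 scale0r.
have Qnext w : Q w -> Q (next w).
  move=> Qw; have [Mw bw] := Qw; have [x [Mx mE _ _]] := pP _ Qw.
  have Mm : M (p w).1 by rewrite mE; exact/algM/Me/algM.
  split; first by apply/algB/algZ/algM/Mw/algM/M_adj.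
  have nextE : 1 - next w =
      (1 - w) + ((p w).2^-1 *: (w * x)) * e * (adj x * adj w * w).
    rewrite /next opprB addrCA addrC; congr (_ + _).
    by rewrite mE !adjM se -!bop_scaleAl -!mulrA [e * (e * _)]mulrA ee.
  have Mr : M (adj x * adj w * w) by apply/algM/Mw/algM; exact: M_adj.
  have Ml : M ((p w).2^-1 *: (w * x)) by exact/algZ/algM.
  have /bounded_mapP[k k0 kP] := bw.
  have /bounded_mapP[l l0 lP] := T_bounded_through_e Ml Mr.
  apply/bounded_mapP; exists (k + l) => [|u]; first by lra.
  rewrite nextE thD; last 2 first.
  - exact: (algB alg1).
  - exact/algM/Mr/algM.
  by rewrite bopDE T_D mulrDl; apply: le_trans (nrmD _ _) (lerD (kP u) (lP u)).
have QW n : Q (W n).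
  elim: n => [|n IH]; last exact: Qnext.
  split; first exact: alg1.
  by exists 0 => u; rewrite subrr th0 bop0E T_0 normr0 mul0r.
pose m k := (p (W k)).1.
have Mm k : M (m k).
  have [x [Mx mE _ _]] := pP _ (QW k); have [MW _] := QW k.
  by rewrite /m mE; exact/algM/Me/algM.
have mm k : adj (m k) * m k = (p (W k)).2 *: e.
  by have [x [_ _ _]] := pP _ (QW k).
have me k : e * adj (m k) = adj (m k).
  have [x [_ mE _ _]] := pP _ (QW k).
  by rewrite /m mE !adjM se !mulrA ee.
have orthW k j : adj (m k) * W (k.+1 + j)%N = 0.
  elim: j => [|j IH].
    rewrite addn0 /= /next mulrBr -bop_scaleAr !mulrA mm -!bop_scaleAl me.
    by rewrite scalerA mulVf ?scale1r ?subrr // c_neq0.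
  rewrite addnS /= /next mulrBr IH -bop_scaleAr.
  have [x [_ mE _ _]] := pP _ (QW (k.+1 + j)%N).
  by rewrite {1}mE !mulrA IH !mul0r scaler0 subrr.
have orth k j : (k < j)%N -> adj (m k) * m j = 0.
  move=> /subnKC <-; have [x [_ mE _ _]] := pP _ (QW (k.+1 + (j - k.+1))%N).
  by rewrite /m mE !mulrA orthW !mul0r.
have [k Tb] := triangular_bounded (fun k => M_adj (Mm k)) orth.
have := Tz _ (algM (M_adj (Mm k)) (Mm k)) Tb.
rewrite mm -bop_scaleAl ez => /eqP; rewrite scaler_eq0 (negPf e0) orbF.
by rewrite (negPf (c_neq0 _ (QW k))).
Qed.

Lemma T_bounded_e :
  (exists z, [/\ e * z = e & forall x, M x -> T_bounded x -> x * z = 0]) ->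
  T_bounded e.
Proof.
move=> /finite_orthogonal_system[w [Mw bw we]]; rewrite /T_bounded.
have -> // : T \o e = fun u => T (th (1 - w) (e u)).
apply/funext => u /=; have -> : th (1 - w) = 1 - th w.
  have -> : - w = (-1) *: w by rewrite scaleN1r.
  rewrite thD ?thZ ?th1 //; [|exact: alg1|exact: algZ].
  by rewrite rmorphN rmorph1 scaleN1r.
by rewrite bopBE bop1E -bopME th_kill // bop0E subr0.
Qed.

End MinimalRange.

Lemma T_is_bounded : bounded_map T.
Proof.
apply: contrapT => Tunb.
have [z [cz z0 Tz]] := discontinuity_projection Tunb.
have [e [Me se ee [ez e0] ecorner]] := minimal_projection_exists cz z0 Tz.
move/eqP: (e0); apply; rewrite -ez; apply: (Tz) => //.
by apply: (T_bounded_e Me se ee e0 ecorner); exists z; split.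
Qed.

End Intertwining.

Theorem proposition3p3 (R : realType) (H : completeNormedModType R[i])
    (dot : {dot H for @conjC R[i]}) (Hdot : induces_norm dot)
    (M : set (H -> H)) (HM : von_neumann_algebra dot M)
    (T Tinv : H -> H) (TK : cancel T Tinv) (TinvK : cancel Tinv T)
    (Tanti : antilinear T)
    (HTM : [set T \o x \o Tinv | x in M] = commutant M)
    (HTZ : forall z : H -> H, centre M z -> is_adjoint dot z (T \o z \o Tinv)) :
  bounded_map T.
Proof.
have [Mb _ _ Madj Mbic] := HM.
pose N : set (bop H) := [set a | M (bop_fun a)].
have bundle (a : H -> H) : bounded_operators a -> exists b : bop H, bop_fun b = a.
  by move=> [la ba]; exists (Bop la ba).
have NE (b : bop H) : N b = M (bop_fun b) by [].
have M'E (b : bop H) : commutant M (bop_fun b) <-> comm N b.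
  split=> [[_ bM] a Na|bN].
    by apply: bopP => u; exact: (congr1 (fun h => h u) (bM _ Na)).
  split; first by split; [exact: bop_linear | exact: bop_bounded].
  move=> x Mx; have [a aE] := bundle _ (Mb _ Mx); rewrite -aE in Mx *.
  by have := congr1 (@bop_fun _ _) (bN a Mx).
have N_adj (x : bop H) : N x -> N (adj Hdot x).
  move=> /Madj[b Mb' xb]; have [c cE] := bundle _ (Mb _ Mb').
  by rewrite (@adj_uniq _ _ _ Hdot x c) /N /= cE.
have N_bicomm (x : bop H) : comm (comm N) x -> N x.
  move=> xN; rewrite NE -Mbic; split.
    by split; [exact: bop_linear | exact: bop_bounded].
  move=> y [yb yM]; have [b bE] := bundle _ yb; rewrite -bE.
  have : comm N b by apply/M'E; rewrite bE.
  by move=> /xN /(congr1 (@bop_fun _ _)).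
have conj_bdd (x : bop H) : exists y : bop H, N x ->
    comm N y /\ bop_fun y = T \o x \o Tinv.
  have [Nx|] := pselect (N x); last by exists 0.
  have M'x : commutant M (T \o x \o Tinv) by rewrite -HTM; exists (bop_fun x).
  have [y yE] := bundle _ (proj1 M'x); exists y => _.
  by split=> //; apply/M'E; rewrite yE.
have [th thP] := choice conj_bdd.
apply: (@T_is_bounded R H dot Hdot N N_adj N_bicomm T Tinv TK TinvK Tanti th).
- by move=> x /thP[].
- move=> y /M'E; rewrite -HTM => -[a Ma aE].
  have [x xE] := bundle _ (Mb _ Ma); rewrite -xE in Ma aE.
  exists x => //; have [_ thx] := thP x Ma.
  by apply: bopP => u; rewrite thx aE.
- by move=> x u /thP[_ ->] /=; rewrite TK.
- move=> z Nz M'z; have [_ thz] := thP z Nz.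
  apply/esym/adj_uniq => u v; rewrite thz; apply: HTZ; split=> //.
  exact/M'E.
Qed.
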